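(* Let $k$ be a field, let $S=k[x_1,\ldots,x_n]$, let $\Delta$ be a pure simplicial complex on $[n]=\{1,\ldots,n\}$ with $\dim\Delta=1$, and let $I=I_\Delta\subset S$ be its Stanley-Reisner ideal. Let $I^{(2)}$ denote the second symbolic power of $I$. Then the following conditions are equivalent: (a) $S/I^{(2)}$ is clean. (b) $S/I^{(2)}$ is Cohen-Macaulay. (c) $\operatorname{diam}\Delta\leq 2$.
   Context: A simplicial complex $\Delta$ on $[n]$ is a collection of subsets of $[n]$ (called faces) closed under taking subsets; its maximal faces under inclusion are called facets. The dimension of a face $F$ is $|F|-1$, and $\dim\Delta$ is the maximum of the dimensions of its facets. $\Delta$ is pure if all its facets have the same dimension. A pure 1-dimensional complex $\Delta$ is regarded as a simple graph, with vertices the $i$ such that $\{i\}\in\Delta$ and edges the facets of $\Delta$. The distance $d(u,v)$ of two vertices is the minimal length of a path from $u$ to $v$ (infinite if there is none), and $\operatorname{diam}\Delta$ is the maximum of $d(u,v)$ over all pairs of vertices $u,v$. The Stanley-Reisner ideal of $\Delta$ is $I_\Delta=(\prod_{i\in F}x_i : F\subseteq[n],\ F\notin\Delta)\subset S$. For $F\subseteq [n]$ put $P_F=(x_i : i\in F)$. Then $I_\Delta=\bigcap_{G} P_{[n]\setminus G}$, where $G$ runs over the facets of $\Delta$, and the $m$-th symbolic power is $I_\Delta^{(m)}=\bigcap_{G} P_{[n]\setminus G}^m$, with $G$ again running over the facets of $\Delta$. For a monomial ideal $I\subset S$, a prime filtration of $S/I$ is a chain of monomial ideals $\mathcal F: I=I_0\subset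 I_1\subset\cdots\subset I_r=S$ such that for each $i=1,\ldots,r$ there is a monomial prime ideal $\mathfrak p_i$ of $S$ with $I_i/I_{i-1}\cong S/\mathfrak p_i$. Put $\operatorname{Supp}\mathcal F=\{\mathfrak p_1,\ldots,\mathfrak p_r\}$. The filtration is clean if $\operatorname{Supp}\mathcal F$ equals the set $\operatorname{Min} I$ of minimal primes of $I$. $S/I$ is called clean if it admits a clean prime filtration. *)

(* Defs.v *)
From mathcomp Require Import all_boot all_order all_algebra.
From mathcomp Require Import mpoly.

Set Implicit Arguments.
Unset Strict Implicit.
Unset Printing Implicit Defensive.

Import GRing.Theory.
Local Open Scope ring_scope.

(* Ideals are Prop-valued predicates, because the boolean [idealr] of
   ring_quotient excludes the unit ideal.  Equality of ideals is [same_ideal].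
   Elements of a quotient ring or module are handled through representatives. *)

Section CommutativeAlgebra.
Variable R : comNzRingType.
Implicit Types (I J A B p q : R -> Prop) (E : R -> Prop) (s : seq R).

Definition sub_ideal I J := forall f, I f -> J f.
Definition same_ideal I J := forall f, I f <-> J f.

Definition is_ideal I :=
  [/\ I 0, forall a b, I a -> I b -> I (a + b) & forall c a, I a -> I (c * a)].

Definition ideal_gen E : R -> Prop := fun f =>
  exists2 s : seq (R * R), (forall ce, ce \in s -> E ce.2)
                         & f = \sum_(ce <- s) ce.1 * ce.2.

Definition ideal_pow I (m : nat) : R -> Prop :=
  ideal_gen (fun f =>
    exists2 g : 'I_m -> R, (forall i, I (g i)) & f = \prod_(i < m) g i).

Definition prime_ideal p :=
  [/\ is_ideal p, ~ p 1 & forall a b, p (a * b) -> p a \/ p b].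

Definition maximal_ideal q :=
  [/\ is_ideal q, ~ q 1
    & forall J, is_ideal J -> sub_ideal q J -> ~ J 1 -> same_ideal J q].

Definition minimal_prime I p :=
  [/\ prime_ideal p, sub_ideal I p
    & forall q, prime_ideal q -> sub_ideal I q -> sub_ideal q p ->
        same_ideal q p].

(* An isomorphism of R-modules B / A -> R / p, for ideals A <= B and p, given
   by a choice [phi] of representatives: [phi] is linear modulo p, takes values
   in p exactly on A, and is onto modulo p.  Linearity and the kernel make the
   induced map on cosets well defined and injective. *)
Definition quotient_iso B A p :=
  exists phi : R -> R,
    [/\ forall c x y, B x -> B y -> p (phi (c * x + y) - (c * phi x + phi y)),
        forall x, B x -> (p (phi x) <-> A x)
      & forall y, exists2 x, B x & p (phi x - y)].

(* The ideal generated by I and the entries of s. *)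
Definition ideal_add_seq I s : R -> Prop :=
  ideal_gen (fun f => I f \/ f \in s).

(* s is a regular sequence on R / I *)
Definition regular_sequence I s :=
  (forall i, (i < size s)%N -> forall h,
      ideal_add_seq I (take i s) (s`_i * h) -> ideal_add_seq I (take i s) h)
  /\ ~ ideal_add_seq I s 1.

(* For q containing I, depth (q / I, R / I) = d: the maximal length of an
   R / I-regular sequence contained in q / I. *)
Definition is_depth I q (d : nat) :=
  (exists s, [/\ regular_sequence I s, forall f, f \in s -> q f & size s = d])
  /\ (forall s, regular_sequence I s -> (forall f, f \in s -> q f) ->
        (size s <= d)%N).

(* c 0 < c 1 < ... < c d is a chain of primes over I *)
Definition prime_chain I (d : nat) (c : nat -> R -> Prop) :=
  (forall i, (i <= d)%N -> prime_ideal (c i) /\ sub_ideal I (c i))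
  /\ (forall i, (i < d)%N ->
        sub_ideal (c i) (c i.+1) /\ ~ sub_ideal (c i.+1) (c i)).

(* The height of the prime q / I of R / I, that is, dim (R / I)_q. *)
Definition is_height I q (d : nat) :=
  (exists2 c, prime_chain I d c & same_ideal (c d) q)
  /\ (forall d' c, prime_chain I d' c -> same_ideal (c d') q -> (d' <= d)%N).

(* R / I is a Cohen-Macaulay ring (R being Noetherian), in the form of
   Eisenbud, Commutative Algebra, Section 18.2: depth and height agree at
   every maximal ideal of R / I.  At a maximal ideal q the depth of q / I on
   R / I is the depth of the local ring (R / I)_q. *)
Definition cohen_macaulay I :=
  forall q, maximal_ideal q -> sub_ideal I q ->
    exists2 d, is_depth I q d & is_height I q d.

End CommutativeAlgebra.

Section MonomialIdeals.
Variables (k : fieldType) (n : nat).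
Local Notation S := {mpoly k[n]}.

Definition monomial_ideal (I : S -> Prop) :=
  exists E : 'X_{1..n} -> Prop,
    same_ideal I (ideal_gen (fun f => exists2 m, E m & f = 'X_[m])).

(* The chain is F 0 < ... < F r, and the index i runs over 0, ..., r - 1, so
   that [p i] is the prime of the factor F i.+1 / F i. *)
Definition prime_filtration (I : S -> Prop) (r : nat)
    (F p : nat -> S -> Prop) :=
  [/\ same_ideal (F 0%N) I,
      same_ideal (F r) (fun _ => True),
      forall i, (i <= r)%N -> monomial_ideal (F i)
    & forall i, (i < r)%N ->
        [/\ sub_ideal (F i) (F i.+1), monomial_ideal (p i), prime_ideal (p i)
          & quotient_iso (F i.+1) (F i) (p i)]].

Definition clean (I : S -> Prop) :=
  exists r F p, prime_filtration I r F p /\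
    forall q, (exists2 i, (i < r)%N & same_ideal q (p i)) <-> minimal_prime I q.

Definition var_ideal (F : {set 'I_n}) : S -> Prop :=
  ideal_gen (fun f => exists2 i, i \in F & f = 'X_i).

End MonomialIdeals.
Arguments var_ideal k {n} F _.

Section SimplicialComplexes.
Variable n : nat.
Implicit Types Delta : {set {set 'I_n}}.

Definition simplicial_complex Delta :=
  forall F G : {set 'I_n}, F \in Delta -> G \subset F -> G \in Delta.

Definition facets Delta : {set {set 'I_n}} :=
  [set F | maxset (fun G : {set 'I_n} => G \in Delta) F].

Definition pure Delta :=
  forall F G, F \in facets Delta -> G \in facets Delta -> #|F| = #|G|.

Definition complex_dim Delta : int := (\max_(F in facets Delta) #|F|)%N%:Z - 1.

Definition vertices Delta : {set 'I_n} := [set i | [set i] \in Delta].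

Definition edge Delta : rel 'I_n :=
  fun u v => (u != v) && ([set u; v] \in facets Delta).

(* u :: s is a path from u to v; its length is [size s]. *)
Definition is_path Delta u v (s : seq 'I_n) :=
  [&& path (edge Delta) u s, uniq (u :: s) & last u s == v].

(* [None] stands for infinity in [is_distance] and [is_diameter]. *)
Definition is_distance Delta u v (d : option nat) :=
  match d with
  | Some d => (exists2 s, is_path Delta u v s & size s = d)
              /\ (forall s, is_path Delta u v s -> (d <= size s)%N)
  | None => forall s, ~~ is_path Delta u v s
  end.

Definition le_onat (d e : option nat) : bool :=
  match d, e with
  | _, None => true
  | None, Some _ => false
  | Some d, Some e => (d <= e)%N
  end.

Definition is_diameter Delta (D : option nat) :=
  (exists u v, [/\ u \in vertices Delta, v \in vertices Delta
                 & is_distance Delta u v D])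
  /\ (forall u v d, u \in vertices Delta -> v \in vertices Delta ->
        is_distance Delta u v d -> le_onat d D).

End SimplicialComplexes.

Section StanleyReisner.
Variables (k : fieldType) (n : nat).
Implicit Types Delta : {set {set 'I_n}}.
Local Notation S := {mpoly k[n]}.

Definition sr_ideal Delta : S -> Prop :=
  ideal_gen (fun f => exists2 F : {set 'I_n}, F \notin Delta
                                            & f = \prod_(i in F) 'X_i).

(* The symbolic power I_Delta^(m); [sr_symbolic_power1] identifies the case
   m = 1 with [sr_ideal Delta]. *)
Definition sr_symbolic_power Delta (m : nat) : S -> Prop :=
  fun f => forall G, G \in facets Delta -> ideal_pow (var_ideal k (~: G)) m f.

End StanleyReisner.
Arguments sr_ideal k {n} Delta _.
Arguments sr_symbolic_power k {n} Delta m _.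

Lemma ideal_gen_ideal (R : comNzRingType) (E : R -> Prop) :
  is_ideal (ideal_gen E).
Proof.
split=> [|a b [s Es ->] [t Et ->]|c a [s Es ->]].
- by exists [::]; rewrite ?big_nil.
- exists (s ++ t); last by rewrite big_cat.
  by move=> ce; rewrite mem_cat => /orP[/Es|/Et].
exists [seq (c * ce.1, ce.2) | ce <- s].
  by move=> _ /mapP[ce /Es Ece ->].
by rewrite big_map mulr_sumr; apply: eq_bigr => ce _; rewrite mulrA.
Qed.

Lemma ideal_gen_mem (R : comNzRingType) (E : R -> Prop) f :
  E f -> ideal_gen E f.
Proof.
move=> Ef; exists [:: (1, f)]; last by rewrite big_seq1 mul1r.
by move=> ce; rewrite inE => /eqP ->.
Qed.

Lemma ideal_gen_sub (R : comNzRingType) (E J : R -> Prop) :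
  is_ideal J -> (forall f, E f -> J f) -> sub_ideal (ideal_gen E) J.
Proof.
case=> J0 JD JM EJ _ [s Es ->]; elim: s Es => [|ce s IHs] Es.
  by rewrite big_nil.
rewrite big_cons; apply: JD; first by apply/JM/EJ/Es/mem_head.
by apply: IHs => x xs; apply: Es; rewrite inE xs orbT.
Qed.

Lemma ideal_pow1 (R : comNzRingType) (I : R -> Prop) :
  is_ideal I -> same_ideal (ideal_pow I 1) I.
Proof.
move=> idI f; split=> [|If]; last first.
  apply: ideal_gen_mem; exists (fun=> f) => //.
  by rewrite big_ord1.
by move: f; apply: ideal_gen_sub => // f [g Ig ->]; rewrite big_ord1.
Qed.

Lemma var_ideal_msupp (k : fieldType) n (F : {set 'I_n}) (f : {mpoly k[n]}) :
  var_ideal k F f ->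
  forall m, m \in msupp f -> exists2 i, i \in F & (0 < m i)%N.
Proof.
case=> s Fs -> m /msupp_sum_le /flattenP[ms] /mapP[ce].
rewrite mem_filter /= => /Fs [i iF ->] -> mX.
exists i => //; move: mX.
rewrite (perm_mem (msuppMX _ _)) => /mapP[m' _ ->].
by rewrite mnmDE mnm1E eqxx.
Qed.

Lemma sr_symbolic_power1 (k : fieldType) n (Delta : {set {set 'I_n}})
    (D_complex : simplicial_complex Delta) :
  same_ideal (sr_ideal k Delta) (sr_symbolic_power k Delta 1).
Proof.
move=> f; split=> [If G|f1].
  rewrite inE => /maxsetP[GD maxG]; apply/(ideal_pow1 (ideal_gen_ideal _)).
  have idP : is_ideal (var_ideal k (~: G)) by apply: ideal_gen_ideal.
  move: f If; apply: ideal_gen_sub => // _ [F FnD ->].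
  have /subsetPn[i iF iG] : ~~ (F \subset G).
    by apply: contra FnD => FG; apply: D_complex GD FG.
  case: idP => _ _ PM; rewrite (bigD1 i) //= mulrC; apply: PM.
  by apply: ideal_gen_mem; exists i; rewrite ?inE.
have [I0 ID IM] : is_ideal (sr_ideal k Delta) by apply: ideal_gen_ideal.
rewrite [f]mpolyE big_seq; apply: big_ind => // m mf.
rewrite -mul_mpolyC; apply: (IM).
pose F := [set i | (0 < m i)%N].
have FnD : F \notin Delta.
  apply/negP => FD; have [G maxG FG] := maxset_exists FD.
  have GD : G \in facets Delta by rewrite inE.
  have /(ideal_pow1 (ideal_gen_ideal _)) fP := f1 G GD.
  have [i + mi] := var_ideal_msupp fP mf.
  by rewrite inE => /negP; apply; apply: (subsetP FG); rewrite inE.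
pose u := (\sum_(i in F) U_(i))%MM.
have le_um : (u <= m)%MM.
  apply/mnm_lepP => i; rewrite mnm_sumE.
  under eq_bigr do rewrite mnm1E.
  have [iF|iF] := boolP (i \in F); last first.
    rewrite big1 // => j jF; case: eqP => // ji.
    by rewrite -ji jF in iF.
  rewrite (bigD1 i) //= eqxx big1 ?addn0; first by rewrite inE in iF.
  by move=> j /andP[_ /negPf ->].
rewrite -(submK le_um) mpolyXD; apply: (IM); apply: ideal_gen_mem.
by exists F; rewrite // mprodXE.
Qed.

(* Main.v *)
From HB Require Import structures.
Require Import Defs.
From Stdlib Require Import ClassicalEpsilon FunctionalExtensionality.
From Stdlib Require Import PropExtensionality.
From mathcomp Require Import all_boot all_order all_algebra.
From mathcomp Require Import mpoly ring zify.

(* Everything is expressed in monomials: I^(2) is spanned by the monomials that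
   have degree at least 2 outside every edge.

   (c) => (a): the monomials outside I^(2) are partitioned into cones
   x^b k[x_i : i in G], G an edge, listed so that every initial union is closed
   under divisors; read backwards the list is a clean filtration.  First come
   the monomials on the edges, then, for each i in turn, those of the form
   x_i u with u on an edge.  In each phase the edges at a root (the vertex i if
   possible) come first, then those that meet a neighbor of the root, then all
   others; as every vertex is at distance at most 2 from the root, each edge
   adds exactly one cone.

   (a) => (b): let q be a maximal ideal over I^(2).  By the Nullstellensatz q
   contains y_i = P_i(x_i) with P_i <> 0 and P_i(0) = 0.  The sums of the y_i
   and of the y_i y_j, i < j, form a regular sequence on the coordinate ring of
   each edge plane, hence along the filtration.  Conversely three elements of S
   satisfy a polynomial relation modulo I^(2), and its lexicographically least
   term rules out both a regular sequence and a chain of primes of length 3.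

   (b) => (c): if u and v are at distance at least 3, then depth 2 fails at
   (x_1, ..., x_n), as shown by a homomorphism from this ideal to S / I^(2)
   built from x_u x_v. *)

Set Implicit Arguments.
Unset Strict Implicit.
Unset Printing Implicit Defensive.

Import GRing.Theory.
Local Open Scope ring_scope.

(** * Ideals, quotient isomorphisms and regular sequences of length two *)

Section IdealTheory.
Variable R : comNzRingType.
Implicit Types (I J A B p q : R -> Prop) (s : seq R).

Lemma ideal0 I : is_ideal I -> I 0. Proof. by case. Qed.

Lemma idealD I a b : is_ideal I -> I a -> I b -> I (a + b).
Proof. by case=> _ + _; apply. Qed.

Lemma idealMl I a b : is_ideal I -> I b -> I (a * b).
Proof. by case=> _ _; apply. Qed.

Lemma idealMr I a b : is_ideal I -> I a -> I (a * b).
Proof. by rewrite mulrC; apply: idealMl. Qed.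

Lemma idealN I a : is_ideal I -> I a -> I (- a).
Proof. by rewrite -mulN1r; apply: idealMl. Qed.

Lemma idealB I a b : is_ideal I -> I a -> I b -> I (a - b).
Proof. by move=> idI Ia Ib; apply/(idealD idI Ia)/(idealN idI). Qed.

Lemma ideal_sum I (T : Type) (r : seq T) (P : pred T) (F : T -> R) :
  is_ideal I -> (forall i, P i -> I (F i)) -> I (\sum_(i <- r | P i) F i).
Proof.
move=> idI IF; apply: big_ind => //; first exact: ideal0.
by move=> a b; apply: idealD.
Qed.

Lemma ideal_subr I a b : is_ideal I -> I (a - b) -> I a -> I b.
Proof. by move=> idI Iab Ia; rewrite -[b](subKr a); apply: idealB. Qed.

Lemma ideal_subl I a b : is_ideal I -> I (a - b) -> I b -> I a.
Proof. by move=> idI Iab Ib; rewrite -[a](subrK b); apply: idealD. Qed.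

Lemma ideal_congr I a b : is_ideal I -> I (a - b) -> (I a <-> I b).
Proof. by split; [apply: ideal_subr|apply: ideal_subl]. Qed.

Lemma prime_ideal_exp p a e : prime_ideal p -> p (a ^+ e) -> p a.
Proof.
case=> _ p1 pM; elim: e => [|e IHe]; first by rewrite expr0.
by rewrite exprS => /pM[|/IHe].
Qed.

Lemma prime_ideal_prod p (T : eqType) (r : seq T) (F : T -> R) :
  prime_ideal p -> p (\prod_(i <- r) F i) -> exists2 i, i \in r & p (F i).
Proof.
case=> _ p1 pM; elim: r => [|i r IHr]; first by rewrite big_nil.
rewrite big_cons => /pM[pFi|/IHr[j rj pFj]].
  by exists i; rewrite ?mem_head.
by exists j; rewrite // inE rj orbT.
Qed.

(** Otherwise q + (a), the ideal [J] below, would be proper and strictly larger than [q]. *)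
Lemma maximal_ideal_inv q a :
  maximal_ideal q -> ~ q a -> exists u, q (a * u - 1).
Proof.
case=> idq q1 maxq qa; apply: NNPP => noinv; apply: qa.
pose J b := exists u, q (b - a * u).
have idJ : is_ideal J.
  split=> [|b c [u qu] [v qv]|c b [u qu]].
  - by exists 0; rewrite mulr0 subr0; apply: ideal0.
  - exists (u + v); rewrite mulrDr opprD addrACA; exact: idealD.
  - by exists (c * u); rewrite mulrCA -mulrBr; apply: idealMl.
have qJ : sub_ideal q J by move=> b qb; exists 0; rewrite mulr0 subr0.
have J1 : ~ J 1.
  by case=> u /(idealN idq); rewrite opprB => qu; apply: noinv; exists u.
apply: (proj1 (maxq J idJ qJ J1 a)); exists 1.
by rewrite mulr1 subrr; apply: ideal0.
Qed.

Lemma maximal_ideal_prime q : maximal_ideal q -> prime_ideal q.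
Proof.
move=> maxq; have [idq q1 _] := maxq; split=> // a b qab.
case: (classic (q a)) => [|/(maximal_ideal_inv maxq)[u qu]]; first by left.
right; have: q (b * (a * u) - b * 1) by rewrite -mulrBr; apply: idealMl.
rewrite mulr1 => /(ideal_subr idq); apply.
by rewrite mulrCA mulrA; apply: idealMr.
Qed.

(* The isomorphism is the inverse of multiplication by [z]. *)
Lemma quotient_iso_colon A B p z :
  is_ideal A -> is_ideal p -> B z ->
  (forall x, B x -> exists y, A (x - z * y)) ->
  (forall y, A (z * y) <-> p y) -> is_ideal B ->
  quotient_iso B A p.
Proof.
move=> idA idp Bz Bgen Ap idB.
(* Moving [B x] under the existential allows a choice function defined on all of [R]. *)
have Bgen' x : exists y, B x -> A (x - z * y).
  case: (classic (B x)) => [/Bgen[y Ay]|Bx]; first by exists y.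
  by exists 0 => /Bx.
pose phi x := proj1_sig (constructive_indefinite_description _ (Bgen' x)).
have phiP x : B x -> A (x - z * phi x).
  by rewrite /phi; case: (constructive_indefinite_description _ _).
exists phi; split=> [c x y Bx By|x Bx|y].
- have Bcxy : B (c * x + y) by apply: idealD => //; apply: idealMl.
  apply/Ap; have := phiP _ Bcxy; have := phiP _ Bx; have := phiP _ By.
  move: (phi x) (phi y) (phi (c * x + y)) => u v w Ay Ax Acxy.
  have -> : z * (w - (c * u + v)) =
      c * (x - z * u) + (y - z * v) - (c * x + y - z * w) by ring.
  by apply: idealB => //; apply: idealD => //; apply: idealMl.
- by rewrite -Ap; apply: iff_sym; apply: ideal_congr => //; apply: phiP.
have Bzy : B (z * y) by apply: idealMr.
exists (z * y) => //; apply/Ap; rewrite mulrBr -opprB.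
by apply: idealN => //; apply: phiP.
Qed.

Lemma ideal_add_seq_ideal I s : is_ideal (ideal_add_seq I s).
Proof. exact: ideal_gen_ideal. Qed.

Lemma ideal_add_seq_base I s : sub_ideal I (ideal_add_seq I s).
Proof. by move=> x Ix; apply: ideal_gen_mem; left. Qed.

Lemma ideal_add_seq_mem I s x : x \in s -> ideal_add_seq I s x.
Proof. by move=> sx; apply: ideal_gen_mem; right. Qed.

Lemma ideal_add_seq_min I s J : is_ideal J -> sub_ideal I J ->
  (forall x, x \in s -> J x) -> sub_ideal (ideal_add_seq I s) J.
Proof. by move=> idJ IJ sJ; apply: ideal_gen_sub => // x [/IJ|/sJ]. Qed.

Lemma ideal_add_seq_sub I s t : {subset s <= t} ->
  sub_ideal (ideal_add_seq I s) (ideal_add_seq I t).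
Proof.
move=> st; apply: ideal_add_seq_min; first exact: ideal_add_seq_ideal.
  exact: ideal_add_seq_base.
by move=> x /st; apply: ideal_add_seq_mem.
Qed.

Lemma ideal_add_seq0 I : is_ideal I -> same_ideal (ideal_add_seq I [::]) I.
Proof.
by move=> idI x; split; [apply: ideal_add_seq_min | apply: ideal_add_seq_base].
Qed.

Lemma ideal_add_seq1 I f x : is_ideal I ->
  ideal_add_seq I [:: f] x <-> exists y, I (x - f * y).
Proof.
move=> idI; split=> [|[y Iy]]; last first.
  have idJ := ideal_add_seq_ideal I [:: f].
  apply: (ideal_subl idJ (b := f * y)); first exact: ideal_add_seq_base.
  by apply: (idealMr y idJ); apply: ideal_add_seq_mem; rewrite inE.
pose J z := exists y, I (z - f * y).
move: x; apply: (@ideal_add_seq_min _ _ J).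
- split=> [|b c [u qu] [v qv]|c b [u qu]].
  + by exists 0; rewrite mulr0 subr0; apply: ideal0.
  + exists (u + v); rewrite mulrDr opprD addrACA; exact: idealD.
  + by exists (c * u); rewrite mulrCA -mulrBr; apply: idealMl.
- by move=> x Ix; exists 0; rewrite mulr0 subr0.
by move=> _ /[!inE]/eqP->; exists 1; rewrite mulr1 subrr; apply: ideal0.
Qed.

(* [f, g] is a regular sequence on the module [B / A], except that
   [(f, g) B + A] may be all of [B]. *)
Definition weakly_regular2 B A f g :=
  (forall x, B x -> A (f * x) -> A x) /\
  (forall x y, B x -> B y -> A (g * x - f * y) ->
     exists2 z, B z & A (x - f * z)).

(** As [phi] is linear only modulo [p], its compatibility with scalars and differences is first
    recovered up to elements of [p]; the two conditions are then carried across. *)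
Lemma weakly_regular2_iso B A p f g : is_ideal A -> is_ideal B -> is_ideal p ->
  quotient_iso B A p -> weakly_regular2 (fun _ => True) p f g ->
  weakly_regular2 B A f g.
Proof.
move=> idA idB idp [phi [phiL phiA phi_onto]] [reg1 reg2].
have B0 := ideal0 idB; have p0 : p (phi 0) by apply/phiA/(ideal0 idA).
have phiM c x : B x -> p (phi (c * x) - c * phi x).
  move=> Bx; have := phiL c x 0 Bx B0.
  rewrite addr0 => pc; rewrite -[_ - _](subrK (phi 0)).
  by apply: idealD => //; rewrite -addrA -opprD.
have phiB c x y : B x -> B y -> p (phi (y - c * x) - (phi y - c * phi x)).
  move=> Bx By; have := phiL (- c) x y Bx By.
  by rewrite !mulNr ![- (c * _) + _]addrC.
split=> [x Bx Afx|x y Bx By Agf].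
  apply/phiA => //; apply: reg1 => //; apply: (ideal_subr idp (phiM f x Bx)).
  by apply/phiA => //; apply: idealMl.
have Bgx : B (g * x) by apply: idealMl.
have [//|//||z _ pz] := reg2 (phi x) (phi y).
  have pgf : p (phi (g * x - f * y)).
    by apply/phiA => //; apply: idealB => //; apply: idealMl.
  have := ideal_subr idp (phiB f y (g * x) By Bgx) pgf.
  apply: ideal_subr => //.
  by rewrite opprB addrA subrK; apply: phiM.
have [w Bw pw] := phi_onto z; exists w => //.
apply/phiA; first by apply: idealB => //; apply: idealMl.
apply: (ideal_subl idp (phiB f w x Bw Bx)).
apply: (ideal_subl idp (b := phi x - f * z)) => //.
have -> : phi x - f * phi w - (phi x - f * z) = - (f * (phi w - z)) by ring.
by apply: idealN => //; apply: idealMl.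
Qed.

(** In 0 -> B/A -> R/A -> R/B -> 0, regularity on the outer terms gives it in the middle: a relation
    g x = f y is solved modulo [B], and the error, a relation in B/A, is solved there. *)
Lemma weakly_regular2_ext B A f g : is_ideal A -> is_ideal B -> sub_ideal A B ->
  weakly_regular2 (fun _ => True) B f g -> weakly_regular2 B A f g ->
  weakly_regular2 (fun _ => True) A f g.
Proof.
move=> idA idB AB [regB1 regB2] [reg1 reg2]; split=> [x _ Afx|x y _ _ Agf].
  by apply: (reg1 _ _ Afx); apply: regB1 => //; apply: AB.
have [z _ Bz] := regB2 x y I I (AB _ Agf).
have Byz : B (y - g * z).
  apply: regB1 => //.
  have -> : f * (y - g * z) = g * (x - f * z) - (g * x - f * y) by ring.
  by apply: idealB => //; [apply: idealMl|apply: AB].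
have [//|//||w Bw Aw] := reg2 (x - f * z) (y - g * z).
  by have -> : g * (x - f * z) - f * (y - g * z) = g * x - f * y by ring.
by exists (z + w) => //; have -> : x - f * (z + w) = x - f * z - f * w by ring.
Qed.

Lemma weakly_regular2_sequence A q f g : is_ideal A -> is_ideal q ->
  sub_ideal A q -> ~ q 1 -> q f -> q g ->
  weakly_regular2 (fun _ => True) A f g -> regular_sequence A [:: f; g].
Proof.
move=> idA idq Aq q1 qf qg [reg1 reg2]; split=> [[|[|i]] //= _ h|]; last first.
- have qs : forall x, x \in [:: f; g] -> q x.
    by move=> x; rewrite !inE => /orP[]/eqP->.
  by move=> /(ideal_add_seq_min idq Aq qs).
- move=> /ideal_add_seq1-/(_ idA)[y Ay]; apply/ideal_add_seq1 => //.
  by have [//|//|//|z _] := reg2 h y; exists z.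
by move=> /ideal_add_seq0-/(_ idA) ?; apply/ideal_add_seq0 => //; apply: reg1.
Qed.

Lemma regular_sequence2 A f g : is_ideal A -> regular_sequence A [:: f; g] ->
  weakly_regular2 (fun _ => True) A f g.
Proof.
move=> idA [reg _]; split=> [x _ Afx|x y _ _ Agf].
  apply/(ideal_add_seq0 idA); apply: (reg 0%N isT x).
  exact/(ideal_add_seq0 idA).
have [] := proj1 (ideal_add_seq1 f x idA) (reg 1%N isT x _).
  by apply/(ideal_add_seq1 _ _ idA); exists y.
by move=> z Az; exists z.
Qed.

End IdealTheory.

(** * Ring morphisms, evaluation of nested polynomials and linear dependence *)

Lemma prime_ideal_preim (A B : comNzRingType) (phi : {rmorphism A -> B})
    (q : B -> Prop) :
  prime_ideal q -> prime_ideal (fun x => q (phi x)).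
Proof.
case=> [[q0 qD qM] q1 qMM]; split=> [||u v]; last first.
- by rewrite rmorphM; apply: qMM.
- by rewrite rmorph1.
split=> [|u v|u v]; first by rewrite rmorph0.
  by rewrite rmorphD; apply: qD.
by rewrite rmorphM; apply: qM.
Qed.

(** Nesting it evaluates polynomials in several variables, one variable at a time. *)
Definition polyeval (A S : comNzRingType) (ev : {rmorphism A -> S}) (f : S) :
  {poly A} -> S := horner_eval f \o map_poly ev.

HB.instance Definition _ A S ev f :=
  GRing.RMorphism.copy (@polyeval A S ev f) (horner_eval f \o map_poly ev).

Lemma polyevalC (A S : comNzRingType) (ev : {rmorphism A -> S}) f c :
  polyeval ev f c%:P = ev c.
Proof. by rewrite /polyeval /= map_polyC /horner_eval hornerC. Qed.

Lemma polyevalX (A S : comNzRingType) (ev : {rmorphism A -> S}) f :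
  polyeval ev f 'X = f.
Proof. by rewrite /polyeval /= map_polyX /horner_eval hornerX. Qed.

Lemma polyeval_poly (A S : comNzRingType) (ev : {rmorphism A -> S}) f N E :
  polyeval ev f (\poly_(i < N) E i) = \sum_(i < N) ev (E i) * f ^+ i.
Proof.
rewrite poly_def rmorph_sum; apply: eq_bigr => i _.
by rewrite -mul_polyC rmorphM rmorphXn /= polyevalC polyevalX.
Qed.

(* Cancel the factor [f ^+ i] of a polynomial relation on [f], where [i] is the
   least exponent that occurs in it. *)
Lemma polyeval_trailing (A S : comNzRingType) (ev : {rmorphism A -> S})
    (J J' : S -> Prop) f p :
  is_ideal J' -> sub_ideal J J' -> J' f -> (forall h, J (f * h) -> J h) ->
  p != 0 -> J (polyeval ev f p) -> exists2 c, c != 0 & J' (ev c).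
Proof.
move=> idJ' JJ' J'f reg; elim/poly_ind: p => [|p c IHp]; first by rewrite eqxx.
rewrite rmorphD rmorphM /= polyevalC polyevalX => pc0 Jpc.
have [c0|c0] := eqVneq c 0.
  move: pc0 Jpc; rewrite c0 polyC0 addr0 rmorph0 addr0 => pX0.
  rewrite mulrC => /reg Jp.
  by apply: IHp Jp; apply: contra_neq pX0 => ->; rewrite mul0r.
exists c => //; move/JJ': Jpc; apply: ideal_subr => //.
by rewrite addrK; apply: idealMl.
Qed.

Lemma left_kernel (F : fieldType) (T1 T2 : finType) (M : T1 -> T2 -> F) :
  (#|T2| < #|T1|)%N ->
  exists2 c : T1 -> F, (exists x, c x != 0) & forall y, \sum_x c x * M x y = 0.
Proof.
move=> ltT.
pose A := \matrix_(i < #|T1|, j < #|T2|) M (enum_val i) (enum_val j).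
have /rowV0Pn[v vker v0] : kermx A != 0.
  rewrite kermx_eq0 /row_free neq_ltn; apply/orP; left.
  exact: leq_ltn_trans (rank_leq_col A) ltT.
exists (fun x => v 0 (enum_rank x)) => [|y].
  have /rV0Pn[j vj] := v0; exists (enum_val j); by rewrite enum_valK.
have /sub_kermxP/rowP/(_ (enum_rank y)) := vker.
rewrite !mxE => vy; rewrite (reindex _ (onW_bij _ (@enum_val_bij T1))) /=.
rewrite -[RHS]vy; apply: eq_bigr => i _.
by rewrite enum_valK !mxE enum_rankK.
Qed.

(** * Monomial ideals as spans, and algebraic relations modulo them *)

Section MonomialSpans.
Variables (k : fieldType) (n : nat).
Local Notation S := {mpoly k[n]}.
Implicit Types (D : 'X_{1..n} -> Prop) (f g : S) (m : 'X_{1..n}).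

(** When [D] is closed under divisors this is a monomial ideal, and [D] gives a basis of the
    quotient. *)
Definition span_compl D : S -> Prop :=
  fun f => forall m, m \in msupp f -> ~ D m.

Definition down_closed D := forall m m', D m -> (m' <= m)%MM -> D m'.

Lemma span_complX D m : span_compl D 'X_[m] <-> ~ D m.
Proof.
split=> [|Dm m']; first by apply; rewrite msuppX mem_head.
by rewrite msuppX inE => /eqP ->.
Qed.

Lemma span_compl_ideal D : down_closed D -> is_ideal (span_compl D).
Proof.
move=> Ddown; split=> [m|f g fD gD m|c f fD m].
- by rewrite msupp0.
- by move/msuppD_le; rewrite mem_cat => /orP[/fD|/gD].
move=> /msuppM_le/allpairsP[[m1 m2] /= [_ /fD Dm2 ->]] Dm.
by apply: Dm2; apply: Ddown Dm _; apply: lem_addl.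
Qed.

Lemma span_compl_gen D (J : S -> Prop) : is_ideal J ->
  (forall m, ~ D m -> J 'X_[m]) -> sub_ideal (span_compl D) J.
Proof.
move=> idJ DJ f fD; rewrite [f]mpolyE big_seq; apply: ideal_sum => // m fm.
by rewrite -mul_mpolyC; apply/(idealMl _ idJ)/DJ/fD.
Qed.

Lemma span_compl_monomial D : down_closed D -> monomial_ideal (span_compl D).
Proof.
move=> Ddown; exists (fun m => ~ D m) => f; split.
  apply: span_compl_gen; first exact: ideal_gen_ideal.
  by move=> m Dm; apply: ideal_gen_mem; exists m.
move: f; apply: ideal_gen_sub => [|f [m Dm ->]]; last exact/span_complX.
exact: span_compl_ideal.
Qed.

Lemma span_compl_sub D D' : (forall m, D' m -> D m) ->
  sub_ideal (span_compl D) (span_compl D').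
Proof. by move=> DD f fD m /fD Dm /DD. Qed.

Lemma mdeg_msuppM f g a b :
  (forall m, m \in msupp f -> mdeg m <= a)%N ->
  (forall m, m \in msupp g -> mdeg m <= b)%N ->
  forall m, m \in msupp (f * g) -> (mdeg m <= a + b)%N.
Proof.
move=> fa gb m /msuppM_le/allpairsP[[m1 m2] /= [/fa m1a /gb m2b ->]].
by rewrite mdegD leq_add.
Qed.

Lemma mdeg_msuppX f a i : (forall m, m \in msupp f -> mdeg m <= a)%N ->
  forall m, m \in msupp (f ^+ i) -> (mdeg m <= i * a)%N.
Proof.
move=> fa; elim: i => [|i IHi] m.
  by rewrite expr0 msupp1 inE => /eqP ->; rewrite mdeg0.
by rewrite exprS mulSn; apply: mdeg_msuppM.
Qed.

(* D has O(N^2) elements of degree O(N), while there are N^3 monomials in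
   f1, f2, f3 with exponents less than N, all of degree O(N). *)
Lemma algebraic_relation D (f1 f2 f3 : S) :
  (forall m, D m -> exists a b (e : option 'I_n) s t,
     m = (oapp (fun i => U_(i)) 0 e + (U_(a) *+ s + U_(b) *+ t))%MM) ->
  exists2 p : {poly {poly {poly k}}}, p != 0 &
    span_compl D (polyeval (polyeval (polyeval (@mpolyC n k) f3) f2) f1 p).
Proof.
move=> Dsmall.
pose d := maxn (msize f1) (maxn (msize f2) (msize f3)).
(* Every [F x] below has degree less than [M], and [N] is chosen so that N^3 exceeds the size n * n
   * (n + 1) * M^2 of [T2], which labels all monomials of [D] of degree less than [M]. *)
pose N := (n * n * n.+1 * (9 * d.+1 * d.+1)).+1.
pose M := (3 * N * d.+1)%N.
pose T2 : finType := ('I_n * 'I_n * option 'I_n * 'I_M * 'I_M)%type.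
pose mon (y : T2) : 'X_{1..n} := let: (a, b, e, s, t) := y in
  (oapp (fun i => U_(i)) 0 e + (U_(a) *+ s + U_(b) *+ t))%MM.
pose F (x : 'I_N * 'I_N * 'I_N) : S := let: (i, j, l) := x in
  f3 ^+ l * f2 ^+ j * f1 ^+ i.
have [|c [x cx] cF] := @left_kernel k _ T2 (fun x y => (F x)@_(mon y)).
  rewrite !card_prod !card_ord card_option card_ord.
  have -> : (n * n * n.+1 * M * M = (N.-1 * N) * N)%N by rewrite /M /N /=; ring.
  by rewrite !ltn_pmul2r //= /N.
pose p : {poly {poly {poly k}}} :=
  \poly_(i < N) \poly_(j < N) \poly_(l < N) c (inord i, inord j, inord l).
have pE : polyeval (polyeval (polyeval (@mpolyC n k) f3) f2) f1 p
    = \sum_x c x *: F x.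
  rewrite (eq_bigr (fun x => c (x.1.1, x.1.2, x.2) *: F (x.1.1, x.1.2, x.2))).
    rewrite -(pair_bigA _ (fun q l => c (q.1, q.2, l) *: F (q.1, q.2, l))) /=.
    rewrite -(pair_bigA _ (fun i j => \sum_l c (i, j, l) *: F (i, j, l))) /=.
    rewrite polyeval_poly; apply: eq_bigr => i _.
    rewrite /= polyeval_poly mulr_suml; apply: eq_bigr => j _.
    rewrite /= polyeval_poly !mulr_suml; apply: eq_bigr => l _.
    by rewrite !inord_val -mul_mpolyC !mulrA.
  by case=> [[]].
exists p.
  apply: contra_neq cx => p0; case: x => [[i j] l].
  have := congr1 (fun q : {poly {poly {poly k}}} => q`_i`_j`_l) p0.
  by rewrite !coef0 !(coef_poly, ltn_ord) !inord_val.
rewrite pE => m mp Dm; move: (mp); rewrite mcoeff_msupp => /eqP; apply.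
rewrite raddf_sum /=.
have [a [b [e [s [t Em]]]]] := Dsmall m Dm.
have degm : (mdeg m < M)%N.
  have := msupp_sum_le mp; rewrite filter_predT.
  case/flattenP=> _ /mapP[[[i j] l] _ ->] /msuppZ_le.
  have f1d m' : m' \in msupp f1 -> (mdeg m' <= d)%N.
    by move=> /msize_mdeg_lt/ltnW/leq_trans; apply; rewrite leq_maxl.
  have f2d m' : m' \in msupp f2 -> (mdeg m' <= d)%N.
    by move=> /msize_mdeg_lt/ltnW/leq_trans; apply; rewrite /d; lia.
  have f3d m' : m' \in msupp f3 -> (mdeg m' <= d)%N.
    by move=> /msize_mdeg_lt/ltnW/leq_trans; apply; rewrite /d; lia.
  move/(mdeg_msuppM (mdeg_msuppM (mdeg_msuppX f3d) (mdeg_msuppX f2d))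
    (mdeg_msuppX f1d)) => /leq_ltn_trans; apply.
  have := ltn_ord i; have := ltn_ord j; have := ltn_ord l; rewrite /M; nia.
have ltM : (s < M)%N /\ (t < M)%N.
  move: degm; rewrite Em !mdegD !mdegMn !mdeg1 !mul1n; lia.
case: ltM => sM tM.
rewrite -[RHS](cF (a, b, e, Ordinal sM, Ordinal tM)); apply: eq_bigr => y _.
by rewrite mcoeffZ /= -Em.
Qed.

End MonomialSpans.

(** * The bound 2 on regular sequences and on chains of primes *)

Section DimensionBound.
Variables (k : fieldType) (n : nat).
Local Notation S := {mpoly k[n]}.
Variable D : 'X_{1..n} -> Prop.
Hypothesis Dsmall : forall m, D m -> exists a b (e : option 'I_n) s t,
  m = (oapp (fun i => U_(i)) 0 e + (U_(a) *+ s + U_(b) *+ t))%MM.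

(** A polynomial relation among the three elements modulo [J 0] loses one variable with each use of
    [polyeval_trailing], until a nonzero constant lies in [J 3]. *)
Lemma nonzerodivisor_chain_unit (J : nat -> S -> Prop) (f : nat -> S) :
  (forall i, is_ideal (J i)) -> sub_ideal (span_compl D) (J 0%N) ->
  (forall i, (i < 3)%N -> [/\ sub_ideal (J i) (J i.+1), J i.+1 (f i)
     & forall h, J i (f i * h) -> J i h]) ->
  J 3 1.
Proof.
move=> idJ DJ regJ.
have [p p0 Dp] := algebraic_relation (f 0%N) (f 1%N) (f 2) Dsmall.
have [J01 Jf0 reg0] := regJ 0%N isT; have [J12 Jf1 reg1] := regJ 1%N isT.
have [J23 Jf2 reg2] := regJ 2 isT.
have [q q0 Dq] := polyeval_trailing (idJ 1%N) J01 Jf0 reg0 p0 (DJ _ Dp).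
have [r r0 Dr] := polyeval_trailing (idJ 2) J12 Jf1 reg1 q0 Dq.
have [c c0 Dc] := polyeval_trailing (idJ 3) J23 Jf2 reg2 r0 Dr.
have -> : 1 = (c^-1)%:MP * c%:MP :> S by rewrite -mpolyCM mulVf.
exact: idealMl.
Qed.

Lemma regular_sequence_size (I : S -> Prop) (s : seq S) :
  is_ideal I -> sub_ideal (span_compl D) I ->
  regular_sequence I s -> (size s <= 2)%N.
Proof.
move=> idI DI [reg s1]; rewrite leqNgt; apply/negP => s3; apply: s1.
apply: (ideal_add_seq_sub (s := take 3 s)) => [x /mem_take //|].
apply: (@nonzerodivisor_chain_unit (fun i => ideal_add_seq I (take i s))
  (fun i => s`_i)).
- by move=> i; apply: ideal_add_seq_ideal.
- by move=> x /DI; apply: ideal_add_seq_base.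
move=> i i3; have si := leq_trans i3 s3; split; last exact: reg.
  apply: ideal_add_seq_sub => x.
  by rewrite (take_nth 0) // mem_rcons inE orbC => ->.
by apply: ideal_add_seq_mem; rewrite (take_nth 0) // mem_rcons mem_head.
Qed.

(** An element of one prime outside the preceding one is a nonzerodivisor modulo the latter, so the
    chain is of the kind treated above. *)
Lemma prime_chain_length d c :
  prime_chain (@span_compl k n D) d c -> (d <= 2)%N.
Proof.
case=> primec subc; rewrite leqNgt; apply/negP => d3.
have exf i : exists f, (i < d)%N -> c i.+1 f /\ ~ c i f.
  case: (ltnP i d) => [/subc[_ cN]|]; last by exists 0.
  apply: NNPP => nof; apply: cN => f cf; apply: NNPP => cif.
  by apply: nof; exists f.
pose f i := proj1_sig (constructive_indefinite_description _ (exf i)).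
have fP i : (i < d)%N -> c i.+1 (f i) /\ ~ c i (f i).
  by rewrite /f; case: (constructive_indefinite_description _ _).
(* Repeating the last prime provides an ideal at every index. *)
pose c' i := c (minn i d).
have primec' i : prime_ideal (c' i).
  by apply: (proj1 (primec _ _)); apply: geq_minr.
have [idc3 c31 _] := primec' 3; apply: c31.
apply: (@nonzerodivisor_chain_unit c' f).
- by move=> i; case: (primec' i).
- by rewrite /c' min0n; case: (primec 0%N).
move=> i i3; have id := leq_trans i3 d3.
have c'i : c' i = c i by rewrite /c' (minn_idPl (ltnW id)).
have c'i1 : c' i.+1 = c i.+1 by rewrite /c' (minn_idPl id).
rewrite c'i c'i1; have [ci1 cNi] := fP i id; split=> // [|h].
  by case: (subc i id).
by have [[_ _ cM] _] := primec i (ltnW id); move/cM => [].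
Qed.

End DimensionBound.

(** * Ideals generated by variables *)

Section VariableIdeals.
Variables (k : fieldType) (n : nat).
Local Notation S := {mpoly k[n]}.
Implicit Types (G : {set 'I_n}) (f g : S) (m : 'X_{1..n}).

Definition mon_on G m := forall j, j \notin G -> m j = 0%N.

(** The order of the monomial along the ideal P of the variables outside [G]: it lies in P^d exactly
    when this is at least d. *)
Definition outdeg G m := (\sum_(j in ~: G) m j)%N.

Lemma outdegD G m m' : outdeg G (m + m')%MM = (outdeg G m + outdeg G m')%N.
Proof. by rewrite -big_split; apply: eq_bigr => j _; rewrite mnmDE. Qed.

Lemma outdeg_le G m m' : (m <= m')%MM -> (outdeg G m <= outdeg G m')%N.
Proof. by move=> /mnm_lepP le_m; apply: leq_sum. Qed.

Lemma outdegU G j : outdeg G U_(j)%MM = (j \notin G).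
Proof.
rewrite /outdeg; have [jG|jG] := boolP (j \in G).
  rewrite big1 // => i; rewrite inE mnm1E; case: eqP => // <-.
  by rewrite jG.
rewrite (bigD1 j) ?inE //= mnm1E eqxx big1 // => i /andP[_ ij].
by rewrite mnm1E eq_sym (negPf ij).
Qed.

Lemma outdeg0P G m : mon_on G m <-> outdeg G m = 0%N.
Proof.
split=> [mG|/eqP]; first by apply: big1 => j; rewrite inE => /mG.
by rewrite sum_nat_eq0 => /forall_inP mG j jG; apply/eqP/mG; rewrite inE.
Qed.

Lemma mon_onD G m m' : mon_on G (m + m')%MM <-> mon_on G m /\ mon_on G m'.
Proof.
split=> [mG|[mG mG'] j jG]; last by rewrite mnmDE mG ?mG'.
by split=> j /mG; rewrite mnmDE => /eqP; rewrite addn_eq0 => /andP[/eqP ? /eqP].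
Qed.

Lemma mon_on_le G m m' : mon_on G m -> (m' <= m)%MM -> mon_on G m'.
Proof.
by move=> mG /mnm_lepP le_m j /mG mj; apply/eqP; rewrite -leqn0 -mj.
Qed.

Lemma outdeg_divisor G m : (0 < outdeg G m)%N ->
  exists2 j, j \notin G & (U_(j) <= m)%MM.
Proof.
rewrite lt0n sum_nat_eq0 => /forall_inPn[j /[!inE] jG mj].
by exists j; rewrite // lep1mP.
Qed.

Lemma down_closed_outdeg G d : down_closed (fun m => outdeg G m < d)%N.
Proof. by move=> m m' md /(outdeg_le G)/leq_ltn_trans; apply. Qed.

Lemma mulX_mem (J : S -> Prop) m m' : is_ideal J -> (m' <= m)%MM ->
  J 'X_[m'] -> J 'X_[m].
Proof.
by move=> idJ le_m Jm'; rewrite -(submK le_m) mpolyXD; apply: idealMl.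
Qed.

(** Outer degrees add under multiplication; conversely a monomial of outer degree at least [d] gives
    up [d] outer variables one by one. *)
Lemma var_ideal_pow G d :
  same_ideal (ideal_pow (var_ideal k (~: G)) d)
             (span_compl (fun m => outdeg G m < d)%N).
Proof.
have idD d' := @span_compl_ideal k _ _ (@down_closed_outdeg G d').
move=> f; split; move: f.
  apply: ideal_gen_sub => // f [g Pg ->]; elim: d g Pg => [|d IHd] g Pg.
    by move=> m _; rewrite ltn0.
  rewrite big_ord_recl => m /msuppM_le/allpairsP[[m1 m2] /= [m1P m2P ->]].
  rewrite outdegD => ltm; apply: (IHd _ (fun i => Pg (lift ord0 i)) m2 m2P).
  have [i iG m1i] := var_ideal_msupp (Pg ord0) m1P.
  have /(outdeg_le G) : (U_(i) <= m1)%MM by rewrite lep1mP -lt0n.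
  by move: iG; rewrite outdegU inE => ->; move: ltm; lia.
apply: span_compl_gen => [|m /negP]; first exact: ideal_gen_ideal.
rewrite -leqNgt => dm.
suff [g Pg [h ->]] : exists2 g : 'I_d -> S, forall i, var_ideal k (~: G) (g i)
    & exists h, 'X_[m] = h * \prod_i g i.
  by apply/(idealMl _ (ideal_gen_ideal _))/ideal_gen_mem; exists g.
elim: d m dm => [|d IHd] m dm.
  by exists (fun=> 0) => [[]//|]; exists 'X_[m]; rewrite big_ord0 mulr1.
have [j jG jm] := outdeg_divisor (leq_ltn_trans (leq0n d) dm).
have [|g Pg [h Eh]] := IHd (m - U_(j))%MM.
  by move: dm; rewrite -{1}(submK jm) outdegD outdegU jG addn1.
exists (fun i => if unlift ord0 i is Some i' then g i' else 'X_j).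
  move=> i; case: (unliftP ord0 i) => [i' _|_]; first exact: Pg.
  by apply: ideal_gen_mem; exists j; rewrite ?inE.
exists h; rewrite big_ord_recl unlift_none -{1}(submK jm) mpolyXD Eh.
rewrite -mulrA [_ * 'X_j]mulrC; congr (_ * (_ * _)).
by apply: eq_bigr => i _; rewrite liftK.
Qed.

Lemma var_idealE G : same_ideal (var_ideal k (~: G)) (span_compl (mon_on G)).
Proof.
have pow1 := ideal_pow1 (ideal_gen_ideal
  (fun f : S => exists2 i, i \in ~: G & f = 'X_i)).
move=> f; split=> [/pow1/var_ideal_pow|] fG.
  by move=> m /fG + /outdeg0P m0; rewrite m0; apply.
apply/pow1/var_ideal_pow => m /fG + m0; apply; apply/outdeg0P.
by case: (outdeg G m) m0.
Qed.

End VariableIdeals.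

(** * Polynomials in two variables *)

(** The top coefficient of [b * w] is the product of the leading ones, so that of [w] lies in [J];
    its leading term is removed and the size drops. *)
Lemma lead_coef_regular (R : comNzRingType) (J : R -> Prop) (b w : {poly R}) :
  is_ideal J -> (forall c, J (lead_coef b * c) -> J c) ->
  (forall i, J (b * w)`_i) -> forall i, J w`_i.
Proof.
move=> idJ b_reg; have [N] := ubnP (size w); elim: N w => // N IHN w.
have [-> _ _ i|w0] := eqVneq w 0; first by rewrite coef0; apply: ideal0.
rewrite ltnS => wN Jbw.
have wS : size w = (size w).-1.+1 by rewrite prednK // size_poly_gt0.
have Jlead : J (lead_coef w).
  have := Jbw ((size b).-1 + (size w).-1)%N; rewrite coefM.
  rewrite (bigD1 (inord (size b).-1)) //= inordK; last by rewrite ltnS leq_addr.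
  rewrite addKn big1 ?addr0 => [Jbl|i /eqP ib].
    exact: b_reg.
  have [lti|lti] := ltnP (size b).-1 i.
    by rewrite [b`__]nth_default ?mul0r // (leq_trans (leqSpred _)).
  rewrite [w`__]nth_default ?mulr0 //.
  have ltib : (i < (size b).-1)%N.
    rewrite ltn_neqAle lti andbT; apply/eqP => E; apply: ib; apply: val_inj.
    by rewrite /= inordK ?ltnS ?leq_addr.
  by rewrite (leq_trans (leqSpred _)) // ltn_subRL ltn_add2r.
pose w' := w - (lead_coef w)%:P * 'X^((size w).-1).
have Jw' : forall i, J w'`_i.
  apply: IHN.
    apply: leq_trans wN; rewrite wS ltnS; apply/leq_sizeP => i.
    rewrite leq_eqVlt => /orP[/eqP <-|wi].
      by rewrite coefB coefCM coefXn eqxx mulr1 subrr.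
    rewrite coefB coefCM coefXn [w`_i]nth_default; last by rewrite wS.
    by rewrite gtn_eqF // mulr0 subrr.
  move=> i; rewrite mulrBr coefB; apply: idealB => //.
  by rewrite mulrCA coefCM; apply: idealMr.
move=> i; have -> : w`_i = w'`_i + lead_coef w * ('X^((size w).-1))`_i.
  by rewrite coefB coefCM subrK.
by apply: idealD => //; apply: idealMr.
Qed.

(** The computation behind [nullstellensatz2]: modulo [P] both [X * L] and [g] are -1, so [f] and
    with it [P * Y - X * f] is invertible. *)
Lemma bezout_mod_identity (R : comNzRingType) (z L Ln h X f u P e g Y : R) :
  P = 1 + X * L -> g = P * u - 1 -> z * Ln = 1 + P * e -> Ln * g = h * f ->
  - (z * L * h) * (P * Y - X * f) =
    1 + P * (P * u - u - 1 + e * (P - 1) * g - z * L * h * Y).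
Proof.
move=> EP Eg Ez Eh.
have E : z * L * h * (X * f) = (1 + P * e) * (P - 1) * g.
  have -> : z * L * h * (X * f) = z * (X * L) * (h * f) by ring.
  by rewrite -Eh -Ez EP; ring.
by rewrite mulrBr !mulNr E opprK Eg; ring.
Qed.

Lemma prime_ideal_coefs (R : comNzRingType) (p : R -> Prop) :
  prime_ideal p -> prime_ideal (fun f : {poly R} => forall i, p f`_i).
Proof.
case=> idp p1 pM; split=> [||f g pfg].
- split=> [i|f g pf pg i|c f pf i]; first by rewrite coef0; apply: ideal0.
    by rewrite coefD; apply: idealD.
  by rewrite coefM; apply: ideal_sum => // j _; apply: idealMl.
- by move/(_ 0%N); rewrite coef1.
case: (classic (forall i, p f`_i)) => [|pNf]; [by left|right].
have [N] := ubnP (size f); elim: N f pNf pfg => // N IHN f pNf pfg.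
rewrite ltnS => fN; case: (classic (p (lead_coef f))) => [pl|pl]; last first.
  by apply: lead_coef_regular pfg => // c /pM[].
have f0 : f != 0.
  by apply: contra_not_neq pNf => -> i; rewrite coef0; apply: ideal0.
pose h := lead_coef f *: 'X^((size f).-1).
have ph i : p h`_i by rewrite coefZ; apply: idealMr.
apply: (IHN (f - h)).
- move=> pfh; apply: pNf => i; have -> : f`_i = (f - h)`_i + h`_i.
    by rewrite coefB subrK.
  exact: idealD.
- move=> i; rewrite mulrBl coefB; apply: idealB => //.
  by rewrite coefM; apply: ideal_sum => // j _; apply: idealMr.
apply: leq_trans fN; rewrite -[X in (_ < X)%N](@prednK (size f)).
  rewrite ltnS; apply/leq_sizeP => i.
  rewrite leq_eqVlt => /orP[/eqP <-|fi].
    by rewrite coefB coefZ coefXn eqxx mulr1 subrr.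
  rewrite coefB coefZ coefXn gtn_eqF // mulr0 subr0 nth_default //.
  exact: leq_trans (leqSpred _) fi.
by rewrite size_poly_gt0.
Qed.

Section TwoVariables.
Variable k : fieldType.
Implicit Types (p : {poly k}) (a b f g : {poly {poly k}}).

(** Modulo [A] the leading coefficient of [b] stays invertible, so [b] is a nonzerodivisor there. *)
Lemma dvd_constant (A : {poly k}) b y w : lead_coef b \is a GRing.unit ->
  A%:P * y = b * w -> exists w1, w = A%:P * w1.
Proof.
move=> b_unit Ayw; exists (\poly_(i < size w) (w`_i %/ A)).
have /lead_coef_regular : is_ideal (fun c : {poly k} => A %| c).
  by split=> *; [apply: dvdp0|apply: dvdp_add|apply: dvdp_mull].
move=> /(_ b w) dvdw; apply/polyP => i; rewrite coefCM coef_poly.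
case: ltnP => [_|wi]; last by rewrite mulr0 nth_default.
rewrite mulrC divpK //; apply: dvdw => [c|j]; last first.
  by rewrite -Ayw coefCM dvdp_mulIl.
by rewrite -{2}[c](mulKr b_unit) => bc; apply: dvdp_mull.
Qed.

(* [A], a polynomial in the inner variable, is coprime to [b] because the
   leading coefficient of [b] is invertible. *)
Lemma regular_sum_prod (A : {poly k}) b : A != 0 ->
  lead_coef b \is a GRing.unit -> (1 < size b)%N ->
  weakly_regular2 (fun _ => True) (fun h => h = 0) (A%:P + b) (A%:P * b).
Proof.
move=> A0 b_unit b1; set a := A%:P.
have lead_ab : lead_coef (a + b) = lead_coef b.
  by rewrite addrC lead_coefDl // (leq_ltn_trans (size_polyC_leq1 _)).
have ab0 : a + b != 0.
  rewrite -lead_coef_eq0 lead_ab; apply: contraTneq b_unit => ->.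
  by rewrite unitr0.
have a0 : a != 0 by rewrite polyC_eq0.
split=> [x _ /eqP|x y _ _ /eqP].
  by rewrite mulf_eq0 (negPf ab0) => /eqP.
rewrite subr_eq0 -mulrA => /eqP E1.
(* [a + b] also has an invertible leading coefficient, so [A] divides [y]; then b (x - y1) = a y1
   makes it divide [x - y1], and the quotient [x1] is the witness. *)
have [||y1 Ey] := @dvd_constant A (a + b) (b * x) y; rewrite ?lead_ab //.
have E2 : b * x = (a + b) * y1.
  by apply: (mulfI a0); rewrite E1 Ey; ring.
have [|x1 Ex] := @dvd_constant A b y1 (x - y1) b_unit.
  by rewrite mulrBr E2; ring.
exists x1 => //; have Ey1 : y1 = b * x1.
  by apply: (mulfI a0); rewrite mulrCA -Ex mulrBr E2; ring.
by rewrite -[x](subrK y1) Ex Ey1; ring.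
Qed.

(** Suppose that [Q] meets k[x] only in 0. Take [f] in [Q] of least degree in the outer variable,
    [l] its leading coefficient, and p = 1 + x l. As [p] is invertible modulo [Q], [f] is a unit
    modulo [p]. So is a monic polynomial [f'] of the same positive degree, which forces [p] to be a
    unit of k[x], although its degree is positive. *)
Lemma nullstellensatz2 (Q : {poly {poly k}} -> Prop) : is_ideal Q -> ~ Q 1 ->
  (forall h, ~ Q h -> exists u : {poly {poly k}}, Q (h * u - 1)) ->
  exists2 p, p != 0 & Q p%:P.
Proof.
move=> idQ Q1 Qmax; apply: NNPP => noQ.
have {}noQ p : p != 0 -> ~ Q p%:P by move=> p0 Qp; apply: noQ; exists p.
have [f [Qf f0 fmin]] : exists f, [/\ Q f, f != 0
    & forall g, Q g -> (size g < size f)%N -> g = 0].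
  (* Without such an [f] the ideal [Q] is zero, and x would be invertible. *)
  apply: NNPP => nomin; have Q0 N g : (size g < N)%N -> Q g -> g = 0.
    elim: N g => // N IHN g; rewrite ltnS => gN Qg; apply/eqP/negP => /negP g0.
    apply: nomin; exists g; split=> // h Qh hg; apply: IHN => //.
    exact: leq_trans hg gN.
  have [|u Qu] := Qmax ('X%:P); first by apply: noQ; rewrite polyX_eq0.
  have /(congr1 (fun h : {poly {poly k}} => (h`_0).[0])) := Q0 _ _ (ltnSn _) Qu.
  rewrite coefB coefCM coef1 coef0 !hornerE => /eqP.
  by rewrite oppr_eq0 oner_eq0.
have f1 : (1 < size f)%N.
  rewrite ltnNge; apply/negP => /size1_polyC Ef.
  by apply: (noQ f`_0); rewrite -?Ef // -polyC_eq0 -Ef.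
have fS : size f = (size f).-1.+1 by rewrite prednK // ltnW.
pose l := lead_coef f; pose s := (size f).-1.
have l0 : l != 0 by rewrite lead_coef_eq0.
pose p := 1 + 'X * l.
have size_p : (1 < size p)%N.
  have lX : (1 < size ('X * l)%R)%N.
    by rewrite mulrC size_mulX // ltnS size_poly_gt0.
  by rewrite /p addrC size_polyDl // size_poly1.
have p0 : p != 0 by rewrite -size_poly_gt0 ltnW.
have [u Qu] := Qmax _ (noQ p p0).
set g := p%:P * u - 1 in Qu.
have E1 := Pdiv.Idomain.divp_eq g f.
have r0 : g %% f = 0.
  apply: fmin; last by rewrite Pdiv.Idomain.ltn_modp.
  have -> : g %% f = lead_coef f ^+ scalp g f *: g - g %/ f * f.
    by rewrite E1 addrAC subrr add0r.
  by apply: idealB => //; [rewrite -mul_polyC|]; apply: idealMl.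
rewrite r0 addr0 in E1; set N := scalp g f in E1; set h := g %/ f in E1.
(* The leading coefficient is p - x l = 1, and modulo [p] this is -x f. *)
pose f' := p%:P * 'X^s - 'X%:P * f.
have coef_s : f'`_s = 1.
  by rewrite coefB !coefCM coefXn eqxx mulr1 /p -/(lead_coef f) -/l addrK.
have size_f' : size f' = size f.
  apply/eqP; rewrite eqn_leq; apply/andP; split; last first.
    rewrite leqNgt fS ltnS; apply/negP => sf'; move: coef_s.
    by rewrite nth_default // => /esym/eqP; rewrite oner_eq0.
  rewrite (leq_trans (size_polyD _ _)) // size_polyN geq_max fS; apply/andP.
  split; last by rewrite mul_polyC (leq_trans (size_scale_leq _ _)) // -fS.
  by rewrite mul_polyC (leq_trans (size_scale_leq _ _)) // size_polyXn.
have f'_monic : f' \is monic by rewrite monicE /lead_coef size_f' coef_s.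
(* Modulo [p] the element -x l is 1, hence so are its powers; [e] is a geometric sum up to sign. *)
have [e Ee] : exists e, (- ('X * l)) ^+ N = 1 + p * e.
  exists (- \sum_(i < N) (- ('X * l)) ^+ i).
  rewrite mulrN -[X in 1 - X]opprK opprK.
  have -> : p = - (- ('X * l) - 1) by rewrite /p; ring.
  by rewrite mulNr -subrX1 opprK addrC subrK.
have [h2 [w E2]] : exists h2 w, h2 * f' = 1 + p%:P * w.
  pose z : {poly {poly k}} := (- 'X%:P) ^+ N.
  have Ez : z * (l ^+ N)%:P = 1 + p%:P * e%:P.
    rewrite -polyCM -polyC1 -polyCD -Ee /z -polyCN -polyC_exp -polyCM -exprMn.
    by rewrite mulNr.
  have Ep : p%:P = 1 + 'X%:P * l%:P by rewrite polyCD polyC1 polyCM.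
  exists (- (z * l%:P * h)).
  exists (p%:P * u - u - 1 + e%:P * (p%:P - 1) * g - z * l%:P * h * 'X^s).
  by apply: bezout_mod_identity Ep _ Ez _; rewrite // mul_polyC.
(* Reducing [w] by the monic [f'] leaves 1 + p r, a multiple of [f'] of smaller degree, hence
   zero. *)
have := Pdiv.RingMonic.rdivp_eq f'_monic w.
set q := Pdiv.Ring.rdivp w f'; set r := Pdiv.Ring.rmodp w f' => Ew.
have size_r : (size r < size f')%N.
  by apply: Pdiv.Ring.ltn_rmodpN0; apply: monic_neq0.
have E3 : (h2 - p%:P * q) * f' = 1 + p%:P * r.
  by rewrite mulrBl E2 Ew; ring.
have pr0 : 1 + p%:P * r = 0.
  apply/eqP/negP => /negP pr0.
  have size_pr : (size (1 + p%:P * r)%R < size f')%N.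
    apply: leq_ltn_trans (size_polyD _ _) _; rewrite gtn_max size_poly1.
    rewrite size_f' f1 -size_f' mul_polyC /=.
    exact: leq_ltn_trans (size_scale_leq _ _) size_r.
  move: size_pr pr0; rewrite -E3; have [->|h0] := eqVneq (h2 - p%:P * q) 0.
    by rewrite mul0r eqxx.
  rewrite size_Mmonic // -subn1 -addnBA; last by rewrite size_f' ltnW.
  by rewrite size_f' fS; have := h0; rewrite -size_poly_gt0; lia.
have : p \is a GRing.unit.
  apply/unitrPr; exists (- r`_0).
  have := congr1 (fun x : {poly {poly k}} => x`_0) pr0.
  rewrite coefD coef1 coefCM coef0 /= => /eqP.
  by rewrite addrC addr_eq0 => /eqP Epr; rewrite mulrN Epr opprK.
by rewrite poly_unitE => /andP[/eqP sp _]; rewrite sp in size_p.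
Qed.

End TwoVariables.

(** * Coordinate planes *)

Section CoordinatePlane.
Variables (k : fieldType) (n : nat).
Local Notation S := {mpoly k[n]}.
Local Notation T := {poly {poly k}}.
Local Notation const := (@polyC {poly k} \o @polyC k).
Local Notation mconst := (@mpolyC n k).
Implicit Types (a b i j : 'I_n) (f g h : S).

Definition line_inj a : {poly k} -> S := polyeval mconst 'X_a.

HB.instance Definition _ a :=
  GRing.RMorphism.copy (line_inj a) (polyeval mconst 'X_a).

Arguments line_inj : simpl never.

Lemma line_injC a c : line_inj a c%:P = c%:MP.
Proof. exact: polyevalC. Qed.

Lemma line_injX a : line_inj a 'X = 'X_a.
Proof. exact: polyevalX. Qed.

Section FixPlane.
Variables a b : 'I_n.

(** The inner variable of [T] stands for x_a and the outer one for x_b. *)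
Definition plane_inj : T -> S := polyeval (line_inj a) 'X_b.

HB.instance Definition _ :=
  GRing.RMorphism.copy plane_inj (polyeval (line_inj a) 'X_b).

Definition plane_proj : S -> T :=
  mmap const (fun i => if i == a then 'X%:P else if i == b then 'X else 0).

HB.instance Definition _ := GRing.RMorphism.copy plane_proj
  (mmap const (fun i => if i == a then 'X%:P else if i == b then 'X else 0)).

Arguments plane_inj : simpl never.
Arguments plane_proj : simpl never.

Lemma plane_injC p : plane_inj p%:P = line_inj a p.
Proof. exact: polyevalC. Qed.

Lemma plane_injX : plane_inj 'X = 'X_b.
Proof. exact: polyevalX. Qed.

Lemma plane_projC c : plane_proj c%:MP = c%:P%:P.
Proof. exact: mmapC. Qed.

Lemma plane_projX i :
  plane_proj 'X_i = if i == a then 'X%:P else if i == b then 'X else 0.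
Proof. by rewrite /plane_proj mmapX mmap1U. Qed.

Lemma plane_proj_line i p :
  plane_proj (line_inj i p) = (map_poly const p).[plane_proj 'X_i].
Proof.
elim/poly_ind: p => [|p c IHp]; first by rewrite !rmorph0 horner0.
rewrite !rmorphD !rmorphM /= IHp line_injX line_injC plane_projC.
by rewrite map_polyX map_polyC hornerMXaddC.
Qed.

Lemma plane_proj_line0 i p : i != a -> i != b -> p.[0] = 0 ->
  plane_proj (line_inj i p) = 0.
Proof.
move=> ia ib p0; rewrite plane_proj_line plane_projX (negPf ia) (negPf ib).
by rewrite -[0](rmorph0 const) horner_map /= p0 !polyC0.
Qed.

Lemma plane_proj_line1 p : plane_proj (line_inj a p) = p%:P.
Proof.
rewrite plane_proj_line plane_projX eqxx.
elim/poly_ind: p => [|p c IHp]; first by rewrite rmorph0 horner0.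
by rewrite !rmorphD !rmorphM /= map_polyX map_polyC hornerMXaddC IHp.
Qed.

Hypothesis ab : a != b.
Local Notation P := (var_ideal k (~: [set a; b])).

Lemma plane_proj_line2 p : plane_proj (line_inj b p) = map_poly polyC p.
Proof.
rewrite plane_proj_line plane_projX eqxx eq_sym (negPf ab).
elim/poly_ind: p => [|p c IHp]; first by rewrite !rmorph0 horner0.
by rewrite !rmorphD !rmorphM /= !map_polyX !map_polyC /= hornerMXaddC IHp.
Qed.

Lemma plane_injK : cancel plane_inj plane_proj.
Proof.
elim/poly_ind => [|p c IHp]; first by rewrite !rmorph0.
rewrite !rmorphD !rmorphM /= IHp plane_injX plane_injC plane_proj_line1.
by rewrite plane_projX eqxx eq_sym (negPf ab).
Qed.

Lemma var_ideal_ideal (F : {set 'I_n}) : is_ideal (var_ideal k F).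
Proof. exact: ideal_gen_ideal. Qed.

(** A monomial with a variable outside the plane lies in [P] and projects to zero; any other is
    recovered exactly. *)
Lemma plane_projK f : P (f - plane_inj (plane_proj f)).
Proof.
have idP := var_ideal_ideal (~: [set a; b]).
rewrite (mpolyE f) (rmorph_sum plane_proj) (rmorph_sum plane_inj) -sumrB /=.
apply: ideal_sum => // m _.
rewrite -mul_mpolyC !rmorphM /= plane_projC plane_injC line_injC -mulrBr.
apply: idealMl => //.
case: (classic (mon_on [set a; b] m)) => [mab|mNab]; last first.
  have m0 : (0 < outdeg [set a; b] m)%N.
    by rewrite lt0n; apply/eqP => /outdeg0P.
  have [j jab jm] := outdeg_divisor m0.
  rewrite -(submK jm) mpolyXD rmorphM /= plane_projX.
  move: (jab); rewrite !inE => /norP[/negPf-> /negPf->].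
  rewrite mulr0 rmorph0 subr0; apply: idealMl => //.
  by apply: ideal_gen_mem; exists j; rewrite // inE.
suff -> : plane_inj (plane_proj 'X_[m]) = 'X_[m].
  by rewrite subrr; apply: ideal0.
rewrite mpolyXE_id !rmorph_prod; apply: eq_bigr => i _.
rewrite !rmorphXn /= plane_projX; have [->|ia] := eqVneq i a.
  by rewrite plane_injC line_injX.
have [->|ib] := eqVneq i b; first by rewrite plane_injX.
by rewrite mab ?expr0 // !inE negb_or ia.
Qed.

Lemma plane_proj_eq0 f : plane_proj f = 0 <-> P f.
Proof.
split=> [f0|]; first by have := plane_projK f; rewrite f0 rmorph0 subr0.
move: f; apply: ideal_gen_sub.
  split=> [|f g f0 g0|c f f0]; first exact: rmorph0.
    by rewrite rmorphD /= f0 g0 addr0.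
  by rewrite rmorphM /= f0 mulr0.
move=> _ [i + ->]; rewrite plane_projX !inE => /norP[/negPf-> /negPf->] //.
Qed.

Lemma var_ideal_plane_prime : prime_ideal P.
Proof.
split=> [||f g]; first exact: var_ideal_ideal.
  by move/plane_proj_eq0; rewrite rmorph1 => /eqP; rewrite oner_eq0.
move/plane_proj_eq0; rewrite rmorphM /= => /eqP.
by rewrite mulf_eq0 => /orP[]/eqP/plane_proj_eq0; [left|right].
Qed.

Lemma plane_weakly_regular2 f g :
  weakly_regular2 (fun _ : T => True) (fun h : T => h = 0)
    (plane_proj f) (plane_proj g) ->
  weakly_regular2 (fun _ => True) P f g.
Proof.
case=> reg1 reg2; split=> [x _ /plane_proj_eq0|x y _ _ /plane_proj_eq0].
  by rewrite rmorphM /= => /reg1-/(_ I)/plane_proj_eq0.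
rewrite rmorphB !rmorphM /= => /reg2-/(_ I I)[z _ Ez].
exists (plane_inj z) => //; apply/plane_proj_eq0.
by rewrite rmorphB rmorphM /= plane_injK.
Qed.

(** The preimage of [q] in [T] satisfies the hypotheses of [nullstellensatz2]: since [P] lies in
    [q], inverses modulo [q] can be projected to the plane. *)
Lemma plane_nullstellensatz (q : S -> Prop) :
  maximal_ideal q -> sub_ideal P q ->
  exists2 p, p != 0 & q (line_inj a p).
Proof.
move=> maxq Pq; have [idq q1 _] := maxq.
have [|||p p0 qp] := @nullstellensatz2 k (q \o plane_inj).
- split=> [|f g|c f] /=; rewrite ?rmorph0 ?rmorphD ?rmorphM /=.
  + exact: ideal0.
  + exact: idealD.
  exact: idealMl.
- by rewrite /= rmorph1.
- move=> h /(maximal_ideal_inv maxq)[u qu]; exists (plane_proj u).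
  rewrite /= rmorphB rmorphM rmorph1; apply: ideal_subl qu => //.
  have -> : plane_inj h * plane_inj (plane_proj u) - 1 - (plane_inj h * u - 1)
    = - (plane_inj h * (u - plane_inj (plane_proj u))) by ring.
  by apply: idealN => //; apply: idealMl => //; apply/Pq/plane_projK.
by exists p => //; rewrite -plane_injC.
Qed.

End FixPlane.

Definition sum_lines (P : 'I_n -> {poly k}) : S :=
  \sum_(i < n) line_inj i (P i).

Definition sum_line_pairs (P : 'I_n -> {poly k}) : S :=
  \sum_(i < n) \sum_(j < n | (i < j)%N) line_inj i (P i) * line_inj j (P j).

(** On the plane the summands P_i(x_i) with i outside {a, b} vanish because P_i(0) = 0, so the two
    sums become y_a + y_b and y_a y_b, as in [regular_sum_prod]. *)
Lemma sum_lines_regular (P : 'I_n -> {poly k}) a b : (a < b)%N ->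
  (forall i, (P i).[0] = 0) -> (forall i, P i != 0) ->
  weakly_regular2 (fun _ => True) (var_ideal k (~: [set a; b]))
    (sum_lines P) (sum_line_pairs P).
Proof.
move=> lt_ab P0 Pn0; have ab : a != b by rewrite neq_ltn lt_ab.
apply: plane_weakly_regular2 => //.
have proj0 i : i != a -> i != b -> plane_proj a b (line_inj i (P i)) = 0.
  by move=> ia ib; apply: plane_proj_line0.
have -> : plane_proj a b (sum_lines P) = (P a)%:P + map_poly polyC (P b).
  rewrite rmorph_sum (bigD1 a) //= (bigD1 b) /= 1?eq_sym // big1 ?addr0.
    by rewrite plane_proj_line1 plane_proj_line2.
  by move=> i /andP[ia ib]; apply: proj0.
have -> : plane_proj a b (sum_line_pairs P) = (P a)%:P * map_poly polyC (P b).
  rewrite rmorph_sum (bigD1 a) //= [X in _ + X]big1 => [|i ia].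
    rewrite addr0 rmorph_sum (bigD1 b) //= big1 => [|j /andP[aj jb]].
      by rewrite addr0 rmorphM /= plane_proj_line1 plane_proj_line2.
    by rewrite rmorphM /= [X in _ * X]proj0 ?mulr0 // neq_ltn aj orbT.
  rewrite rmorph_sum big1 // => j ij; rewrite rmorphM /=.
  have [ib|ib] := eqVneq i b; last by rewrite proj0 ?mul0r.
  rewrite ib in ij; rewrite [X in _ * X]proj0 ?mulr0 // neq_ltn ?ij ?orbT //.
  by rewrite (ltn_trans lt_ab ij) orbT.
have PbS := polySpred (Pn0 b).
have PbN0 : size (map_poly polyC (P b)) = size (P b).
  by rewrite size_map_inj_poly // => x y /polyC_inj.
apply: regular_sum_prod => //.
  rewrite lead_coef_map_inj //; last exact: polyC_inj.
  rewrite poly_unitE size_polyC coefC eqxx /= lead_coef_eq0 Pn0.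
  by rewrite unitfE lead_coef_eq0 Pn0.
rewrite PbN0 ltnNge; apply/negP => /size1_polyC Eb.
by have := P0 b; have := Pn0 b; rewrite Eb hornerC polyC_eq0 => /eqP.
Qed.

End CoordinatePlane.

(** * The ideal of a family of edges: primes, height and depth *)

Lemma same_ideal_eq (R : comNzRingType) (I J : R -> Prop) :
  same_ideal I J -> I = J.
Proof.
by move=> IJ; apply: functional_extensionality => f;
  apply: propositional_extensionality.
Qed.

Section EdgeIdeal.
Variables (k : fieldType) (n : nat) (E : {set {set 'I_n}}).
Hypothesis E2 : forall G, G \in E -> #|G| = 2.
Local Notation S := {mpoly k[n]}.
Implicit Types (G : {set 'I_n}) (f g : S) (m : 'X_{1..n}) (q : S -> Prop).

(** For the facets, the monomials outside the second symbolic power; see [sr_symbolic_power2]. *)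
Definition low m := exists2 G, G \in E & (outdeg G m < 2)%N.

Local Notation I := (@span_compl k n low).

Lemma low_down_closed : down_closed low.
Proof.
move=> m m' [G GE Gm] le_m; exists G => //.
exact: down_closed_outdeg Gm le_m.
Qed.

Lemma low_ideal : is_ideal I.
Proof. exact: span_compl_ideal low_down_closed. Qed.

Lemma edgeP G : G \in E -> exists a b : 'I_n, (a < b)%N /\ G = [set a; b].
Proof.
move=> /E2/eqP/cards2P[a [b [ab ->]]].
have [lt_ab|lt_ba|] := ltngtP a b; first by exists a, b.
  by exists b, a; rewrite setUC.
by move=> /val_inj/eqP; rewrite (negPf ab).
Qed.

Lemma mon_on2 a b m : a != b -> mon_on [set a; b] m ->
  m = (U_(a) *+ m a + U_(b) *+ m b)%MM.
Proof.
move=> ab mab; apply/mnmP => i; rewrite mnmDE !mulmnE !mnm1E.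
have [<-|ai] := eqVneq a i; first by rewrite eq_sym (negPf ab) mul1n addn0.
have [<-|bi] := eqVneq b i; first by rewrite mul1n.
by rewrite mab // !inE negb_or eq_sym ai eq_sym.
Qed.

(** At most one variable occurs outside the edge, with exponent one; [e] records it. *)
Lemma low_small m : low m -> exists a b (e : option 'I_n) s t,
  m = (oapp (fun i => U_(i)) 0 e + (U_(a) *+ s + U_(b) *+ t))%MM.
Proof.
case=> G /edgeP[a [b [lt_ab ->]]] m2.
have ab : a != b by rewrite neq_ltn lt_ab.
have [m0|m0] := posnP (outdeg [set a; b] m).
  exists a, b, None, (m a), (m b); rewrite add0m; apply: mon_on2 => //.
  exact/outdeg0P.
have [j jab jm] := outdeg_divisor m0.
exists a, b, (Some j), ((m - U_(j))%MM a), ((m - U_(j))%MM b).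
rewrite /= -(@mon_on2 a b (m - U_(j))%MM ab); first by rewrite addmC submK.
apply/outdeg0P; move: m2; rewrite -{1}(submK jm) outdegD outdegU jab.
by rewrite addn1 !ltnS leqn0 => /eqP.
Qed.

Lemma low_sub_var G : G \in E -> sub_ideal I (var_ideal k (~: G)).
Proof.
move=> GE f If; apply/var_idealE => m /If + /outdeg0P m0; apply.
by exists G; rewrite ?m0.
Qed.

Lemma var_ideal_edge_prime G : G \in E -> prime_ideal (var_ideal k (~: G)).
Proof.
move=> /edgeP[a [b [lt_ab ->]]]; apply: var_ideal_plane_prime.
Qed.

(** Otherwise every edge has an outer variable not in [q]. The product of their squares has outer
    degree at least 2 at every edge, so it lies in [I] but not in [q]. *)
Lemma prime_over_low q : prime_ideal q -> sub_ideal I q ->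
  exists2 G, G \in E & sub_ideal (var_ideal k (~: G)) q.
Proof.
move=> prq Iq; have [idq _ _] := prq; apply: NNPP => noG.
have exm G : exists m : 'X_{1..n}, G \in E -> ~ q 'X_[m] /\ (1 < outdeg G m)%N.
  case: (classic (G \in E)) => [GE|GE]; last by exists 0%MM => /GE.
  have [j jG qj] : exists2 j, j \notin G & ~ q 'X_j.
    apply: NNPP => noj; apply: noG; exists G => //.
    apply: ideal_gen_sub => // _ [j /[!inE] jG ->]; apply: NNPP => qj.
    by apply: noj; exists j.
  exists (U_(j) *+ 2)%MM => _; split.
    by rewrite -mpolyXn => /(prime_ideal_exp prq).
  by rewrite mulmS mulm1n outdegD outdegU jG.
pose mG G := proj1_sig (constructive_indefinite_description _ (exm G)).
have mGP G : G \in E -> ~ q 'X_[mG G] /\ (1 < outdeg G (mG G))%N.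
  by rewrite /mG; case: (constructive_indefinite_description _ _).
have : q 'X_[\sum_(G <- enum E) mG G]%MM.
  apply/Iq/span_complX => -[G GE]; rewrite ltnNge => /negP; apply.
  have [_ /leq_trans] := mGP _ GE; apply; apply: outdeg_le.
  rewrite (bigD1_seq G) ?enum_uniq ?mem_enum //=; exact: lem_addr.
rewrite -mprodXE => /(prime_ideal_prod prq)[G /[!mem_enum] GE].
by case: (mGP _ GE).
Qed.

(** By [prime_over_low] only these primes can be minimal, and they are pairwise incomparable because
    all edges have the same size. *)
Lemma minimal_prime_low q :
  minimal_prime I q <-> exists2 G, G \in E & q = var_ideal k (~: G).
Proof.
split=> [[prq Iq minq]|[G GE ->]].
  have [G GE Gq] := prime_over_low prq Iq; exists G => //.
  apply/esym/same_ideal_eq/minq => //; first exact: var_ideal_edge_prime.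
  exact: low_sub_var.
split=> [||p prp Ip pG]; [exact: var_ideal_edge_prime|exact: low_sub_var|].
have [G' G'E G'p] := prime_over_low prp Ip.
suff G'G : G' = G by move=> f; split=> [/pG //|]; rewrite -G'G; apply: G'p.
apply/esym/eqP; rewrite eqEcard !E2 // leqnn andbT; apply/subsetP => j jG.
apply/negPn/negP => jG'.
have : var_ideal k (~: G) 'X_j.
  by apply/pG/G'p/ideal_gen_mem; exists j; rewrite ?inE.
move=> /var_idealE/span_complX; apply=> i iG; rewrite mnm1E.
by case: eqP jG iG => // -> ->.
Qed.

Lemma monomial_ideal_ideal (J : S -> Prop) : monomial_ideal J -> is_ideal J.
Proof. by case=> X /same_ideal_eq ->; apply: ideal_gen_ideal. Qed.

(** Induction downwards from the zero module at the top, one factor at a time; [d] counts the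
    steps. *)
Lemma filtration_weakly_regular (J : S -> Prop) r F p f g :
  prime_filtration J r F p ->
  (forall i, (i < r)%N -> weakly_regular2 (fun _ => True) (p i) f g) ->
  weakly_regular2 (fun _ => True) J f g.
Proof.
case=> /same_ideal_eq <- Fr Fmon Fp regp.
suff regF d : (d <= r)%N -> weakly_regular2 (fun _ => True) (F (r - d)%N) f g.
  by rewrite -(subnn r); apply: regF.
elim: d => [_|d IHd dr].
  rewrite subn0 (same_ideal_eq Fr); split=> [//|x y _ _ _].
  by exists (0 : S).
have rd : (r - d.+1 < r)%N by rewrite ltn_subrL (leq_trans _ dr).
have Sd : (r - d.+1).+1 = (r - d)%N by rewrite subnSK.
have [sF _ [idp _ _] isoF] := Fp _ rd.
have idA := monomial_ideal_ideal (Fmon _ (ltnW rd)).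
have idB := monomial_ideal_ideal (Fmon _ rd).
apply: (weakly_regular2_ext idA idB sF); first by rewrite Sd; apply/IHd/ltnW.
exact: weakly_regular2_iso isoF (regp _ rd).
Qed.

Lemma coordinate_polynomials q : maximal_ideal q -> sub_ideal I q ->
  exists P : 'I_n -> {poly k},
    forall i, [/\ (P i).[0] = 0, P i != 0 & q (line_inj i (P i))].
Proof.
move=> maxq Iq; have [idq _ _] := maxq.
have [G /edgeP[a [b [lt_ab ->]]] Gq] :=
  prime_over_low (maximal_ideal_prime maxq) Iq.
have ab : a != b by rewrite neq_ltn lt_ab.
have exP i : exists P, [/\ P.[0] = 0, P != 0 & q (line_inj i P)].
  suff [p p0 qp] : exists2 p, p != 0 & q (line_inj i p).
    (* The factor ['X] makes the polynomial vanish at 0. *)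
    exists (p * 'X); split; first by rewrite hornerMX mulr0.
      by rewrite mulf_neq0 // polyX_eq0.
    by rewrite rmorphM; apply: idealMr.
  have [->|ia] := eqVneq i a; first exact: plane_nullstellensatz maxq Gq.
  have [->|ib] := eqVneq i b.
    by apply: (plane_nullstellensatz (b := a)) maxq _; rewrite setUC.
  exists 'X; rewrite ?polyX_eq0 // line_injX; apply/Gq/ideal_gen_mem.
  by exists i; rewrite // !inE negb_or ia.
exists (fun i => proj1_sig (constructive_indefinite_description _ (exP i))).
by move=> i; case: (constructive_indefinite_description _ _).
Qed.

(** For an edge {a, b} with ideal P inside [q], the chain is P, then [c1], generated by P and the
    polynomials in x_a that lie in [q], then [q]. Polynomials of [q] in x_a alone and in x_b alone
    make the inclusions strict. *)
Lemma height_low q : maximal_ideal q -> sub_ideal I q -> is_height I q 2.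
Proof.
move=> maxq Iq; split; last first.
  by move=> d c chain_c _; apply: (prime_chain_length low_small chain_c).
have prq := maximal_ideal_prime maxq; have [idq q1 _] := maxq.
have [G GE] := prime_over_low prq Iq.
have [a [b [lt_ab EG]]] := edgeP GE; rewrite {}EG in GE * => Gq.
have ab : a != b by rewrite neq_ltn lt_ab.
have [p p0 qp] := plane_nullstellensatz maxq Gq.
have [|r r0 qr] := plane_nullstellensatz (a := b) (b := a) maxq.
  by rewrite setUC.
pose c1 (f : S) := forall i, q (line_inj a (plane_proj a b f)`_i).
have prc1 : prime_ideal c1.
  apply: (@prime_ideal_preim _ {poly {poly k}} (plane_proj a b)
    (fun h => forall i, q (line_inj a h`_i))).
  exact: (prime_ideal_coefs (prime_ideal_preim (line_inj a) prq)).
have Pc1 : sub_ideal (var_ideal k (~: [set a; b])) c1.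
  move=> f /(plane_proj_eq0 a b) f0 i.
  by rewrite f0 coef0 rmorph0; apply: ideal0.
have c1q : sub_ideal c1 q.
  move=> f c1f; apply: ideal_subl (Gq _ (plane_projK a b f)) _ => //.
  rewrite -[plane_proj a b f]coefK poly_def rmorph_sum; apply: ideal_sum => //.
  move=> i _; rewrite -mul_polyC rmorphM /= plane_injC; exact: idealMr.
exists (fun i => if i is j.+1 then if j is 0 then c1 else q
               else var_ideal k (~: [set a; b])) => //.
split=> [[|[|[|i]]] //= _|[|[|i]] //= _].
- by split; [apply: var_ideal_edge_prime|apply: low_sub_var].
- by split=> // f If; apply: Pc1; apply: low_sub_var If.
- split=> // c1P; have /c1P/(plane_proj_eq0 a b) : c1 (line_inj a p).
    move=> i; rewrite plane_proj_line1 coefC; case: eqP => // _.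
    by rewrite rmorph0; apply: ideal0.
  by rewrite plane_proj_line1 => /eqP; rewrite polyC_eq0 (negPf p0).
(* The coefficients of r(x_b) over k[x_a] are constants, and [q] contains no nonzero constant. *)
split=> // qc1; have := qc1 _ qr (size r).-1.
rewrite plane_proj_line2 // coef_map_id0 // line_injC => qlead.
apply: q1; have -> : 1 = ((lead_coef r)^-1)%:MP * (lead_coef r)%:MP :> S.
  by rewrite -mpolyCM mulVf ?lead_coef_eq0.
exact: idealMl.
Qed.

Lemma clean_cohen_macaulay : clean I -> cohen_macaulay I.
Proof.
case=> r [F [p [filt suppP]]] q maxq Iq.
exists 2; last exact: height_low.
have idI := low_ideal; have [idq q1 _] := maxq.
have [P PP] := coordinate_polynomials maxq Iq.
have qP i : q (line_inj i (P i)) by case: (PP i).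
split; last first.
  by move=> s regs _; apply: (regular_sequence_size low_small) regs.
have qf : q (sum_lines P) by apply: ideal_sum.
have qg : q (sum_line_pairs P).
  by apply: ideal_sum => // i _; apply: ideal_sum => // j _; apply: idealMl.
exists [:: sum_lines P; sum_line_pairs P]; split=> //; last first.
  by move=> f; rewrite !inE => /orP[]/eqP->.
apply: (weakly_regular2_sequence idI idq Iq q1 qf qg).
apply: filtration_weakly_regular filt _ => i ir.
(* Cleanness makes every prime factor minimal, hence the ideal of an edge plane. *)
have /minimal_prime_low[G /edgeP[a [b [lt_ab ->]]] ->] : minimal_prime I (p i).
  by apply/suppP; exists i.
by apply: sum_lines_regular => // j; case: (PP j).
Qed.

End EdgeIdeal.

(** * Cohen-Macaulayness bounds the diameter *)

Section CommonNeighbor.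
Variables (k : fieldType) (n : nat) (E : {set {set 'I_n}}).
Hypothesis E2 : forall G, G \in E -> #|G| = 2.
Local Notation S := {mpoly k[n]}.
Implicit Types (G : {set 'I_n}) (f g h : S) (m : 'X_{1..n}).

Definition adjacent : rel 'I_n := fun a b => (a != b) && ([set a; b] \in E).

Lemma edge_adjacent G a b : G \in E -> a \in G -> b \in G -> a != b ->
  adjacent a b.
Proof.
move=> GE aG bG ab; rewrite /adjacent ab /=.
suff -> : [set a; b] = G by [].
apply/eqP; rewrite eqEcard E2 // cards2 ab andbT.
by apply/subsetP => j /[!inE] /orP[]/eqP ->.
Qed.

Local Notation I := (@span_compl k n (low E)).
Local Notation mm := (@span_compl k n (fun m => m = 0%MM)).

Lemma irrelevant_ideal_maximal : maximal_ideal mm.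
Proof.
have down0 : down_closed (fun m : 'X_{1..n} => m = 0%MM).
  move=> m m' -> /mnm_lepP le_m; apply/mnmP => i; apply/eqP.
  by rewrite mnm0E -leqn0; move: (le_m i); rewrite mnm0E.
split; first exact: span_compl_ideal.
  by move=> /(_ 0%MM); rewrite msupp1 mem_head => /(_ isT).
move=> J idJ mJ J1 f; split=> [Jf m fm m0|/mJ //]; apply: J1.
have f0 : f@_0%MM != 0 by rewrite -mcoeff_msupp -m0.
have -> : 1 = ((f@_0%MM)^-1)%:MP * (f@_0%MM)%:MP :> S.
  by rewrite -mpolyCM mulVf.
apply: idealMl => //; apply: ideal_subr Jf => //; apply: mJ => m'.
rewrite mcoeff_msupp => + m'0; rewrite m'0 mcoeffB mcoeffC eqxx mulr1 subrr.
by rewrite eqxx.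
Qed.

Lemma irrelevant_ideal_split (N : {set 'I_n}) h : mm h ->
  exists hA hB, [/\ var_ideal k (~: N) hA, var_ideal k N hB & h = hA + hB].
Proof.
have idA := var_ideal_ideal k (~: N); have idB := var_ideal_ideal k N.
move: h; apply: span_compl_gen => [|m /eqP m0].
  split=> [|f g [fA [fB [fAP fBP ->]]] [gA [gB [gAP gBP ->]]]|c f].
  - by exists 0, 0; rewrite addr0; split=> //; apply: ideal0.
  - exists (fA + gA), (fB + gB); rewrite addrACA.
    by split=> //; apply: idealD.
  move=> [fA [fB [fAP fBP ->]]].
  by exists (c * fA), (c * fB); rewrite mulrDr; split=> //; apply: idealMl.
have [j jm] : exists j, (U_(j) <= m)%MM.
  move: m0; rewrite -mdeg_eq0 mdegE sum_nat_eq0 => /forallPn[j].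
  by rewrite implyTb => mj; exists j; rewrite lep1mP.
have [jN|jN] := boolP (j \in N).
  exists 0, 'X_[m]; rewrite add0r; split=> //; first exact: ideal0.
  by apply: mulX_mem jm _ => //; apply: ideal_gen_mem; exists j.
exists 'X_[m], 0; rewrite addr0; split=> //; last exact: ideal0.
by apply: mulX_mem jm _ => //; apply: ideal_gen_mem; exists j; rewrite ?inE.
Qed.

(* If [u] and [v] are at distance at least 3, multiplication by
   [x_u x_v] and projection to the variables in the closed neighborhood of [u]
   define a homomorphism from the irrelevant ideal to [S / I].  It is not
   multiplication by an element, so the depth is at most 1. *)
Lemma cohen_macaulay_common_neighbor u v :
  cohen_macaulay I -> (exists2 G, G \in E & u \in G) ->
  (exists2 G, G \in E & v \in G) -> u != v -> ~~ adjacent u v ->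
  exists w, adjacent u w && adjacent w v.
Proof.
move=> CM [Gu GuE uGu] [Gv GvE vGv] uv nuv; apply: NNPP => now.
pose N := [set j | (j == u) || adjacent u j].
have vN : v \notin N by rewrite inE negb_or eq_sym uv.
have idI := low_ideal k E.
pose z : S := 'X_u * 'X_v.
(* For i outside [N] and j in [N], the monomial x_u x_v x_i x_j has outer degree at least 2 at every
   edge: an edge through u misses v and i, an edge through v misses u and j, since j is no common
   neighbor, and any other edge misses u and v. *)
have AB hA hB : var_ideal k (~: N) hA -> var_ideal k N hB -> I (z * hA * hB).
  move: hA; apply: ideal_gen_sub => [|_ [i /[!inE]/norP[iu nui] ->]].
    split=> [|f g fP gP hBP|c f fP hBP].
    - by rewrite mulr0 mul0r => _; exact: ideal0 idI.
    - by rewrite mulrDr mulrDl; exact: idealD idI (fP hBP) (gP hBP).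
    by rewrite mulrCA -mulrA; exact: idealMl idI (fP hBP).
  move: hB; apply: ideal_gen_sub => [|_ [j jN ->]].
    split=> [|f g fP gP|c f fP].
    - by rewrite mulr0; exact: ideal0 idI.
    - by rewrite mulrDr; apply: (idealD idI).
    by rewrite mulrCA; apply: (idealMl _ idI).
  rewrite /z -!mpolyXD; apply/span_complX => -[G GE].
  rewrite !outdegD !outdegU => lt2.
  have [uG|uG] := boolP (u \in G).
    have vG : v \notin G by apply: contra nuv => /(edge_adjacent GE uG); apply.
    have iG : i \notin G.
      by apply: contra nui => /(edge_adjacent GE uG); apply; rewrite eq_sym.
    by rewrite vG iG in lt2; move: lt2; case: (_ \notin _).
  have [vG|vG] := boolP (v \in G); last by rewrite uG vG in lt2.
  have jG : j \notin G.
    apply/negP => jG; have jv : j != v.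
      by apply: contraNneq vN => <-.
    have ajv := edge_adjacent GE jG vG jv.
    move: jN; rewrite inE => /orP[/eqP ju|auj].
      by move: nuv; rewrite -ju ajv.
    by apply: now; exists j; rewrite auj.
  by rewrite uG jG in lt2; move: lt2; case: (_ \notin _); case: (_ \notin _).
have maxm := irrelevant_ideal_maximal.
have Im : sub_ideal I mm.
  apply: span_compl_sub => m ->; exists Gu; rewrite // /outdeg big1 // => i _.
  by rewrite mnm0E.
(* Depth equals height, which is at least 2, so there is a regular sequence f, g of length exactly
   2. *)
have [d [[s [regs sm size_s]] _] [_ /(_ _ _ _)hd]] := CM _ maxm Im.
have d2 : (2 <= d)%N.
  by have [[c chain_c cm] _] := height_low E2 maxm Im; apply: hd chain_c cm.
have s2 := regular_sequence_size (low_small E2) idI (fun f fI => fI) regs.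
case: s regs sm size_s s2 => [|f [|g [|]]] regs sm size_s // _;
  try by rewrite -size_s in d2.
have [reg1 reg2] := regular_sequence2 idI regs.
have [fA [fB [fAP fBP Ef]]] := irrelevant_ideal_split N (sm f (mem_head _ _)).
have [|gA [gB [gAP gBP Eg]]] := @irrelevant_ideal_split N g.
  by apply: sm; rewrite !inE eqxx orbT.
(* As h -> z hB respects multiplication modulo [I], regularity of f, g gives [w] with z fB = f w;
   cancelling f shows next that the whole map is multiplication by [w]. *)
have [//|//||w _ Iw] := reg2 (z * fB) (z * gB).
  have -> : g * (z * fB) - f * (z * gB) = z * gA * fB - z * fA * gB.
    by rewrite Ef Eg; ring.
  by apply: (idealB idI); apply: AB.
have hom hA hB : var_ideal k (~: N) hA -> var_ideal k N hB ->
    I (z * hB - (hA + hB) * w).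
  move=> hAP hBP; apply: reg1 => //.
  have -> : f * (z * hB - (hA + hB) * w) =
      z * fA * hB - z * hA * fB + (hA + hB) * (z * fB - f * w).
    by rewrite Ef; ring.
  apply: (idealD idI); last exact: (idealMl _ idI).
  by apply: (idealB idI); apply: AB.
have coef0 f' m : I f' -> low E m -> f'@_m = 0.
  by move=> If' lowm; apply: memN_msupp_eq0; apply/negP => /If'; apply.
have uN : var_ideal k N 'X_u.
  by apply: ideal_gen_mem; exists u; rewrite // inE eqxx.
have vN' : var_ideal k (~: N) 'X_v.
  by apply: ideal_gen_mem; exists v; rewrite // inE.
have lowu : low E (U_(u) + (U_(u) + U_(v)))%MM.
  by exists Gu; rewrite // !outdegD !outdegU uGu; case: (_ \notin _).
have lowv : low E (U_(v) + (U_(u) + U_(v)))%MM.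
  by exists Gv; rewrite // !outdegD !outdegU vGv; case: (_ \notin _).
(* Taking h = x_v makes the coefficient of x_u x_v in [w] equal to 0, taking h = x_u makes it 1. *)
have w0 := coef0 _ _ (hom _ _ vN' (ideal0 (var_ideal_ideal _ _))) lowv.
have w1 := coef0 _ _ (hom _ _ (ideal0 (var_ideal_ideal _ _)) uN) lowu.
move: w0 w1; rewrite mulr0 sub0r addr0 add0r mcoeffN mulrC mcoeffMX.
move=> /eqP; rewrite oppr_eq0 => /eqP w0.
rewrite [z * _]mulrC -mulrBr mulrC mcoeffMX mcoeffB.
rewrite /z -mpolyXD mcoeffX eqxx w0 subr0 => /eqP.
by rewrite oner_eq0.
Qed.

End CommonNeighbor.

(** * Shelling the monomials outside the ideal *)

Lemma pred_ext (T : Type) (A B : T -> Prop) : (forall x, A x <-> B x) -> A = B.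
Proof.
by move=> AB; apply: functional_extensionality => x;
  apply: propositional_extensionality.
Qed.

Section Shelling.
Variables (k : fieldType) (n : nat) (E : {set {set 'I_n}}).
Hypothesis E2 : forall G, G \in E -> #|G| = 2.
Local Notation S := {mpoly k[n]}.
Implicit Types (G : {set 'I_n}) (m u : 'X_{1..n}) (D : 'X_{1..n} -> Prop).
Implicit Types (a b : 'I_n) (L : seq {set 'I_n}).

Definition cone e G m := exists2 u, mon_on G u & m = (e + u)%MM.

(** Each new cone is disjoint from the earlier ones. The sets are given up to pointwise
    equivalence. *)
Inductive shelled : ('X_{1..n} -> Prop) -> Prop :=
| shelled_empty D : (forall m, ~ D m) -> shelled D
| shelled_cone D D' e G : shelled D -> G \in E ->
    (forall u, mon_on G u -> ~ D (e + u)%MM) ->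
    (forall m, D' m <-> D m \/ cone e G m) -> down_closed D' -> shelled D'.

Lemma shelled_down_closed D : shelled D -> down_closed D.
Proof. by case=> // D0 D0P m m' /D0P. Qed.

(** Multiplication by x^e carries the monomials on [G], a basis of S/P_G, onto the cone, a basis of
    the quotient. *)
Lemma cone_quotient_iso D D' e G :
  down_closed D -> down_closed D' -> (forall u, mon_on G u -> ~ D (e + u)%MM) ->
  (forall m, D' m <-> D m \/ cone e G m) ->
  quotient_iso (@span_compl k n D) (span_compl D') (var_ideal k (~: G)).
Proof.
move=> downD downD' De D'E.
have idD := @span_compl_ideal k _ _ downD.
have idD' := @span_compl_ideal k _ _ downD'.
have De0 : ~ D e by rewrite -[e]addm0; apply: De => j _; rewrite mnm0E.
apply: (quotient_iso_colon (z := 'X_[e])) => //.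
- exact: var_ideal_ideal.
- exact/span_complX.
- pose J (x : S) := exists y : S, span_compl D' (x - 'X_[e] * y).
  suff : sub_ideal (span_compl D) J by [].
  apply: span_compl_gen => [|m Dm].
    split=> [|b c [u qu] [v qv]|c b [u qu]].
    + by exists 0; rewrite mulr0 subr0; exact: ideal0 idD'.
    + by exists (u + v); rewrite mulrDr opprD addrACA; exact: (idealD idD').
    by exists (c * u); rewrite mulrCA -mulrBr; exact: (idealMl _ idD').
  case: (classic (cone e G m)) => [[u _ ->]|Cm].
    by exists 'X_[u]; rewrite -mpolyXD subrr; exact: ideal0 idD'.
  exists 0; rewrite mulr0 subr0; apply/span_complX.
  by move=> /D'E[].
move=> y; split=> [ey|].
  apply/var_idealE => m my mG; apply: (ey (e + m)%MM).
    by rewrite mulrC (perm_mem (msuppMX _ _)) map_f.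
  by apply/D'E; right; exists m.
move=> /var_idealE yG m; rewrite mulrC (perm_mem (msuppMX _ _)).
move=> /mapP[u uy ->] /D'E[|[u' u'G /addmI Eu]].
  by move=> /downD; move/(_ e (lem_addr _ _)).
by apply: (yG u uy); rewrite Eu.
Qed.

(** A larger set of monomials has a smaller ideal, so the last cone yields the first step of the
    filtration. *)
Lemma shelled_filtration D : shelled D -> exists r F p,
  prime_filtration (@span_compl k n D) r F p /\
  forall i, (i < r)%N -> exists2 G, G \in E & p i = var_ideal k (~: G).
Proof.
elim=> {D} [D D0|D D' e G shD IHD GE De D'E downD'].
  exists 0%N, (fun=> span_compl D), (fun=> span_compl D); split=> //.
  split=> // [f|i _]; first by split=> // _ m _; apply: D0.
  by apply: span_compl_monomial => m m' /D0.
have [r [F [p [[F0 Fr Fmon Fp] pE]]]] := IHD.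
have downD := shelled_down_closed shD.
exists r.+1, (fun i => if i is j.+1 then F j else span_compl D').
exists (fun i => if i is j.+1 then p j else var_ideal k (~: G)).
split=> [|[_|i /pE //]]; last by exists G.
split=> // [[_|i /Fmon //]|[_|i /Fp //]]; first exact: span_compl_monomial.
rewrite (same_ideal_eq F0); split.
- by apply: span_compl_sub => m Dm; apply/D'E; left.
- rewrite (same_ideal_eq (@var_idealE k _ G)); apply: span_compl_monomial.
  by move=> m m'; apply: mon_on_le.
- exact: (var_ideal_edge_prime k E2).
exact: cone_quotient_iso De D'E.
Qed.

(** Every minimal prime [q] occurs: where the chain leaves [q], the prime of the factor multiplies
    an element outside [q] into [q], so it lies in [q] and equals it by minimality. *)
Lemma shelled_clean : shelled (low E) -> clean (@span_compl k n (low E)).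
Proof.
move=> /shelled_filtration[r [F [p [filt pE]]]]; exists r, F, p; split=> // q.
split=> [[i ir /same_ideal_eq ->]|minq].
  by apply/(minimal_prime_low E2 _)/pE.
have [[F0 Fr Fmon Fp] [prq Iq minq']] := (filt, minq).
have [idq q1 qM] := prq.
have [i [ir Fiq Fi1q]] : exists i, [/\ (i < r)%N, sub_ideal (F i) q
    & ~ sub_ideal (F i.+1) q].
  apply: NNPP => noi; apply: q1.
  have Fq d : (d <= r)%N -> sub_ideal (F d) q.
    elim: d => [_|d IHd dr]; first by rewrite (same_ideal_eq F0).
    by apply: NNPP => NFq; apply: noi; exists d; split=> //; apply/IHd/ltnW.
  by apply: (Fq r (leqnn r)); apply/Fr.
have [FF _ prp [phi [phiL phiA _]]] := Fp i ir; have [idp _ _] := prp.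
have idF := monomial_ideal_ideal (Fmon _ (ltnW ir)).
have idF1 := monomial_ideal_ideal (Fmon _ ir).
have [y Fy qy] : exists2 y, F i.+1 y & ~ q y.
  apply: NNPP => noy; apply: Fi1q => y Fy; apply: NNPP => qy.
  by apply: noy; exists y.
have pq : sub_ideal (p i) q.
  move=> c pc; have [|//|//] := qM c y; apply: Fiq.
  apply/phiA; first exact: idealMl.
  have F10 := ideal0 idF1; have p0 : p i (phi 0) by apply/phiA/(ideal0 idF).
  have := phiL c y 0 Fy F10; rewrite addr0 => pL; apply: (ideal_subl idp pL).
  by apply: idealD => //; apply: idealMr.
exists i => //; have [G GE pG] := pE i ir.
have [prpi Ipi _] : minimal_prime (span_compl (low E)) (p i).
  by apply/(minimal_prime_low E2 _); exists G.
by move=> f; split=> [/(minq' _ prpi Ipi pq)|/pq].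
Qed.

Definition bimon a b s t : 'X_{1..n} := (U_(a) *+ s + U_(b) *+ t)%MM.

Lemma bimonE a b s t (j : 'I_n) :
  bimon a b s t j = ((a == j) * s + (b == j) * t)%N.
Proof. by rewrite mnmDE !mulmnE !mnm1E. Qed.

Lemma bimonD a b s t s' t' :
  bimon a b (s + s') (t + t') = (bimon a b s t + bimon a b s' t')%MM.
Proof. by apply/mnmP => j; rewrite mnmDE !bimonE !mulnDr addnACA. Qed.

Lemma bimon_onP a b s t G : a != b ->
  mon_on G (bimon a b s t) <-> ((0 < s)%N -> a \in G) /\ ((0 < t)%N -> b \in G).
Proof.
move=> ab; split=> [mG|[aG bG] j jG].
  split; apply: contraTT => /mG; rewrite bimonE eqxx.
    by rewrite eq_sym (negPf ab) mul1n mul0n addn0 => ->.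
  by rewrite (negPf ab) mul0n add0n mul1n => ->.
rewrite bimonE; have [aj|_] := eqVneq a j.
  case: s aG => [_|s /(_ isT)]; last by rewrite aj (negPf jG).
  have [bj|_] := eqVneq b j; last by [].
  by move: ab; rewrite aj bj eqxx.
have [bj|//] := eqVneq b j.
by case: t bG => [_|t /(_ isT)]; rewrite ?muln0 // bj (negPf jG).
Qed.

(* A plane of monomials whose intersection with [D] is the complement of a
   translated quadrant costs a single cone. *)
Lemma shelled_quadrant D D' e a b s0 t0 : a != b -> [set a; b] \in E ->
  shelled D -> (forall m, D' m <-> D m \/ cone e [set a; b] m) ->
  down_closed D' ->
  (forall s t, D (e + bimon a b s t)%MM <-> (s < s0)%N || (t < t0)%N) ->
  shelled D'.
Proof.
move=> ab GE shD D'E downD' trD.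
have onab s t : mon_on [set a; b] (bimon a b s t).
  by apply/bimon_onP => //; rewrite !inE !eqxx orbT.
(* The apex is the corner of the missing quadrant. *)
apply: (@shelled_cone D _ (e + bimon a b s0 t0)%MM [set a; b]) => // [u uG|m].
  rewrite (mon_on2 ab uG) -addmA -bimonD => /trD.
  by rewrite !ltnNge !leq_addr.
rewrite D'E; split=> [] [Dm|[u uG ->]]; try by left.
  have [/trD|] := boolP ((u a < s0) || (u b < t0))%N.
    by rewrite /bimon -mon_on2 //; left.
  rewrite negb_or -!leqNgt => /andP[s0u t0u]; right.
  exists (bimon a b (u a - s0) (u b - t0)) => //.
  by rewrite -addmA -bimonD !subnKC // /bimon -mon_on2.
right; exists (bimon a b s0 t0 + u)%MM; last by rewrite addmA.
by apply/mon_onD.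
Qed.

Definition covered L a := has (fun G => a \in G) L.

(** With both exponents positive the edge would be {a, b} itself, which [L] omits; so one exponent
    is zero. *)
Lemma bimon_on_seq L a b s t :
  {subset L <= E} -> a != b -> [set a; b] \notin L ->
  (exists2 G, G \in L & mon_on G (bimon a b s t)) <->
  [|| [&& s == 0%N, t == 0%N & L != [::]], (s == 0%N) && covered L b
    | (t == 0%N) && covered L a].
Proof.
move=> LE ab abL; split=> [[G GL /(bimon_onP _ _ _ ab)[aG bG]]|].
  have L0 : L != [::] by case: L GL {LE abL}.
  case: s t aG bG => [|s] [|t] aG bG; rewrite ?L0 ?eqxx //=.
  - by rewrite orbF; apply/hasP; exists G => //; apply: bG.
  - by apply/hasP; exists G => //; apply: aG.
  case/negP: abL; suff -> : [set a; b] = G by [].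
  apply/eqP; rewrite eqEcard E2 ?LE // cards2 ab andbT.
  by apply/subsetP => j /[!inE] /orP[]/eqP ->; [apply: aG|apply: bG].
case/or3P=> [/and3P[/eqP -> /eqP ->]|/andP[/eqP -> /hasP[G GL bG]]
            |/andP[/eqP -> /hasP[G GL aG]]].
- case: L {LE abL} => // G L _; exists G; rewrite ?mem_head //.
  exact/bimon_onP.
- by exists G => //; apply/bimon_onP.
by exists G => //; apply/bimon_onP.
Qed.

End Shelling.

(** * The order in which the cones are added *)

Section ShellingOrder.
Variables (n : nat) (E : {set {set 'I_n}}).
Hypothesis E2 : forall G, G \in E -> #|G| = 2.
Implicit Types (G : {set 'I_n}) (m u : 'X_{1..n}) (D : 'X_{1..n} -> Prop).
Implicit Types (a b i j : 'I_n) (L : seq {set 'I_n}).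
Local Notation adj := (adjacent E).

Definition vert i := [exists G in E, i \in G].

Definition facet_mon m := exists2 G, G \in E & mon_on G m.

(* Degree at most 1 outside some edge, the outer variable being one of the
   first [c]. *)
Definition low_upto (c : nat) m :=
  facet_mon m \/
  exists2 j : 'I_n, (j < c)%N & exists2 G, G \in E & cone U_(j)%MM G m.

(** The stage of phase [i] after the edges in [L]. *)
Definition low_partial i L m :=
  low_upto i m \/ exists2 G, G \in L & cone U_(i)%MM G m.

Lemma adj_vert a b : adj a b -> vert a.
Proof.
by case/andP=> _ abE; apply/exists_inP; exists [set a; b]; rewrite // !inE eqxx.
Qed.

Lemma cone_le j G m m' : cone U_(j)%MM G m -> (m' <= m)%MM ->
  mon_on G m' \/ cone U_(j)%MM G m'.
Proof.
case=> u uG -> le_m; have [jm|jm] := boolP (U_(j) <= m')%MM.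
  right; exists (m' - U_(j))%MM; last by rewrite addmC submK.
  apply: (mon_on_le uG); apply/mnm_lepP => i.
  by have /mnm_lepP/(_ i) := le_m; rewrite mnmDE mnmBE; lia.
left; apply: (mon_on_le uG); apply/mnm_lepP => i.
move: jm; rewrite lep1mP negbK => /eqP jm.
have /mnm_lepP/(_ i) := le_m; rewrite mnmDE mnm1E.
by case: eqP => [<-|//]; rewrite jm.
Qed.

Lemma low_upto_down c : down_closed (low_upto c).
Proof.
move=> m m' [[G GE mG]|[j jc [G GE mG]]] le_m.
  by left; exists G => //; apply: mon_on_le mG le_m.
have [m'G|m'G] := cone_le mG le_m; first by left; exists G.
by right; exists j => //; exists G.
Qed.

Lemma low_partial_down i L : {subset L <= E} -> down_closed (low_partial i L).
Proof.
move=> LE m m' [mi|[G GL mG]] le_m; first by left; apply: low_upto_down mi le_m.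
have [m'G|m'G] := cone_le mG le_m; last by right; exists G.
by left; left; exists G; rewrite ?LE.
Qed.

(** The exponents for which x_i x_a^s x_b^t lives on an edge; [ia] and [ib] tell whether i is
    adjacent to a and b, [v] whether it is a vertex. *)
Definition facet_trace (ia ib v : bool) (s t : nat) :=
  [|| (s == 0%N) && ib, (t == 0%N) && ia | [&& s == 0%N, t == 0%N & v]].

Lemma facet_mon_bimon i a b s t : i \notin [set a; b] -> a != b ->
  facet_mon (U_(i) + bimon a b s t)%MM <->
  facet_trace (adj i a) (adj i b) (vert i) s t.
Proof.
rewrite !inE negb_or => /andP[ia ib] ab.
have iG G : mon_on G U_(i)%MM <-> i \in G.
  split=> [iG|iG j jG]; first by apply: contraT => /iG; rewrite mnm1E eqxx.
  by rewrite mnm1E; case: eqP jG => // <-; rewrite iG.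
split=> [[G GE /mon_onD[/iG Gi /(bimon_onP _ _ _ ab)[aG bG]]]|].
  have iv : vert i by apply/exists_inP; exists G.
  have iaP : a \in G -> adj i a by move=> Ga; apply: (edge_adjacent E2 GE).
  have ibP : b \in G -> adj i b by move=> Gb; apply: (edge_adjacent E2 GE).
  case: s t aG bG => [|s] [|t] aG bG; rewrite /facet_trace ?iv ?orbT //=.
  - by rewrite ibP ?bG.
  - by rewrite iaP ?aG.
  have : (#|i |: [set a; b]| <= #|G|)%N.
    apply: subset_leq_card; apply/subsetP => j; rewrite !inE.
    by case/or3P=> /eqP ->; rewrite ?aG ?bG.
  by rewrite (E2 GE) cardsU1 cards2 ab !inE negb_or ia ib.
case/or3P=> [/andP[/eqP-> /andP[_ GE]]|/andP[/eqP-> /andP[_ GE]]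
            |/and3P[/eqP-> /eqP-> /exists_inP[G GE Gi]]].
- exists [set i; b] => //; apply/mon_onD; split.
    by apply/iG; rewrite !inE eqxx.
  by apply/bimon_onP => //; rewrite !inE eqxx orbT.
- exists [set i; a] => //; apply/mon_onD; split.
    by apply/iG; rewrite !inE eqxx.
  by apply/bimon_onP => //; rewrite !inE eqxx orbT.
exists G => //; apply/mon_onD; split; first exact/iG.
exact/bimon_onP.
Qed.

(** A variable x_j with j < i that is split off must be x_a or x_b, which lowers [s] or [t] by
    one. *)
Lemma low_upto_bimon i a b s t : i \notin [set a; b] -> a != b ->
  let tr := facet_trace (adj i a) (adj i b) (vert i) in
  low_upto i (U_(i) + bimon a b s t)%MM <->
  [|| tr s t, [&& (a < i)%N, (0 < s)%N & tr s.-1 t]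
    | [&& (b < i)%N, (0 < t)%N & tr s t.-1]].
Proof.
move=> iab ab tr.
have shiftl s' : (U_(i) + bimon a b s'.+1 t)%MM =
    (U_(a) + (U_(i) + bimon a b s' t))%MM.
  by apply/mnmP => j; rewrite !mnmDE !mulmnE !mnm1E; ring.
have shiftr t' : (U_(i) + bimon a b s t'.+1)%MM =
    (U_(b) + (U_(i) + bimon a b s t'))%MM.
  by apply/mnmP => j; rewrite !mnmDE !mulmnE !mnm1E; ring.
split=> [[/facet_mon_bimon-/(_ iab ab) Ht|[j ji [G GE [u uG Eu]]]]|].
- by rewrite /tr Ht.
- have := congr1 (fun m : 'X_{1..n} => m j) Eu.
  rewrite !mnmDE !mulmnE !mnm1E eqxx.
  have -> : (i == j) = false by rewrite -val_eqE gtn_eqF.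
  have [aj|_] := eqVneq a j.
    case: s {shiftr} shiftl Eu => [|s] shiftl Eu.
      have [bj|_] := eqVneq b j; first by rewrite aj bj eqxx in ab.
      by rewrite muln0 mul0n.
    move: Eu; rewrite shiftl aj => /addmI Eu _.
    have /facet_mon_bimon : facet_mon (U_(i) + bimon j b s t)%MM.
      by exists G; rewrite ?Eu.
    rewrite -aj in ji * => /(_ iab ab) Ht; by rewrite /tr ji /= Ht orbT.
  have [bj|_] := eqVneq b j; last by [].
  case: t {shiftl} shiftr Eu => [|t] shiftr Eu; first by rewrite mul0n muln0.
  move: Eu; rewrite shiftr bj => /addmI Eu _.
  have /facet_mon_bimon : facet_mon (U_(i) + bimon a j s t)%MM.
    by exists G; rewrite ?Eu.
  by rewrite -bj in ji * => /(_ iab ab) Ht; rewrite /tr ji /= Ht !orbT.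
case/or3P=> [tr0|/and3P[ai s0 tr0]|/and3P[bi t0 tr0]].
- by left; apply/facet_mon_bimon.
- have /facet_mon_bimon-/(_ iab ab)[G GE mG] := tr0.
  right; exists a => //; exists G => //.
  by rewrite -(prednK s0) shiftl; eexists; first exact: mG.
have /facet_mon_bimon-/(_ iab ab)[G GE mG] := tr0.
right; exists b => //; exists G => //.
by rewrite -(prednK t0) shiftr; eexists; first exact: mG.
Qed.

(* [ka], [kb]: [a], [b] is covered by an earlier edge; [L0]: there is an earlier
   edge. *)
Lemma trace_quadrant (ka kb L0 ia ib v ai bi : bool) :
  (ia -> v) -> (ib -> v) -> (ka -> L0) -> (kb -> L0) ->
  (if v then [|| ia, ib | ka && kb] else [|| ~~ L0, ka | kb]) ->
  let tr := facet_trace ia ib v in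
  exists s0 t0, forall s t,
    [|| [|| tr s t, [&& ai, (0 < s)%N & tr s.-1 t]
          | [&& bi, (0 < t)%N & tr s t.-1]],
        [&& s == 0%N, t == 0%N & L0], (s == 0%N) && kb | (t == 0%N) && ka]
    = (s < s0)%N || (t < t0)%N.
Proof.
move=> iav ibv kaL kbL ok tr.
(* The line s = 0 is full if b is adjacent to i or covered; splitting off x_a also fills s = 1 when
   a < i and b is adjacent to i. Symmetrically for t. The hypothesis on [v] ensures that full lines
   absorb the stray points near the origin. *)
exists (if ib || kb then (ai && ib).+1 else 0%N).
exists (if ia || ka then (bi && ia).+1 else 0%N) => s t.
rewrite /tr /facet_trace {tr}; move/implyP: iav; move/implyP: ibv.
move/implyP: kaL; move/implyP: kbL; move: ok.
by case: v ia ib L0 ka kb ai bi => [] [] [] [] [] [] [] [] //= _ _ _ _ _;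
  case: s => [|[|s]]; case: t => [|[|t]].
Qed.

Lemma coneU e G m : cone e G (e + m)%MM <-> mon_on G m.
Proof. by split=> [[u uG /addmI ->]|mG]; last by exists m. Qed.

Lemma low_partial_step i L G : {subset L <= E} -> G \in E ->
  (if vert i then [|| i \in G, [exists a in G, adj i a]
                    | [forall a in G, covered L a]]
   else (L == [::]) || [exists a in G, covered L a]) ->
  shelled E (low_partial i L) -> shelled E (low_partial i (rcons L G)).
Proof.
move=> LE GE ok shL.
have stepE m : low_partial i (rcons L G) m <->
    low_partial i L m \/ cone U_(i)%MM G m.
  split=> [[|[G']]|[[|[G' G'L]]|]]; first by left; left.
  - rewrite mem_rcons inE => /orP[/eqP ->|]; first by right.
    by left; right; exists G'.
  - by left.
  - by right; exists G'; rewrite // mem_rcons inE G'L orbT.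
  by right; exists G; rewrite // mem_rcons mem_head.
(* This serves repeated edges and edges through [i], whose cones at x_i are made of monomials on the
   edge. *)
have trivial_step : (forall m, cone U_(i)%MM G m -> low_partial i L m) ->
    shelled E (low_partial i (rcons L G)).
  move=> Gtriv; suff -> : low_partial i (rcons L G) = low_partial i L by [].
  by apply: pred_ext => m; rewrite stepE; split=> [[|/Gtriv]|] //; left.
have [GL|GL] := boolP (G \in L).
  by apply: trivial_step => m mG; right; exists G.
have [iG|iG] := boolP (i \in G).
  apply: trivial_step => m [u uG ->]; left; left; exists G => //.
  apply/mon_onD; split=> // j jG; rewrite mnm1E.
  by case: eqP jG => // <-; rewrite iG.
have [a [b [lt_ab EG]]] := edgeP E2 GE; rewrite {}EG in GE ok stepE GL iG *.
have ab : a != b by rewrite neq_ltn lt_ab.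
have [|||||s0 [t0 tr]] := @trace_quadrant (covered L a) (covered L b)
  (L != [::]) (adj i a) (adj i b) (vert i) (a < i)%N (b < i)%N.
- exact: adj_vert.
- exact: adj_vert.
- by case: L {LE GL shL trivial_step stepE ok}.
- by case: L {LE GL shL trivial_step stepE ok}.
- move: ok; rewrite (negPf iG) /= negbK; case: (vert i).
    case/orP=> [/exists_inP[c]|/forall_inP cov].
      by rewrite !inE => /orP[]/eqP -> ->; rewrite ?orbT.
    by rewrite !cov ?orbT // !inE eqxx ?orbT.
  case/orP=> [->//|/exists_inP[c]].
  by rewrite !inE => /orP[]/eqP -> ->; rewrite ?orbT.
apply: (shelled_quadrant (s0 := s0) (t0 := t0) ab GE shL stepE) => [|s t].
  apply: low_partial_down => G'; rewrite mem_rcons inE => /orP[/eqP ->|/LE] //.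
rewrite -tr; split=> [[/(low_upto_bimon _ _ iG ab) ->//|[G' G'L /coneU mG]]|].
  by apply/orP; right; apply/(bimon_on_seq E2 _ _ LE ab GL); exists G'.
case/orP=> [/(low_upto_bimon _ _ iG ab)|/(bimon_on_seq E2 _ _ LE ab GL)].
  by left.
by move=> [G' G'L mG]; right; exists G' => //; apply/coneU.
Qed.

Definition facet_partial L m := exists2 G, G \in L & mon_on G m.

Lemma facet_partial_step L G : {subset L <= E} -> G \in E ->
  (L == [::]) || [exists a in G, covered L a] ->
  shelled E (facet_partial L) -> shelled E (facet_partial (rcons L G)).
Proof.
move=> LE GE ok shL.
have stepE m : facet_partial (rcons L G) m <->
    facet_partial L m \/ cone 0%MM G m.
  split=> [[G']|[[G' G'L]|]].
  - rewrite mem_rcons inE => /orP[/eqP ->|]; last by left; exists G'.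
    by right; exists m; rewrite ?add0m.
  - by exists G'; rewrite // mem_rcons inE G'L orbT.
  by case=> u uG ->; exists G; rewrite ?mem_rcons ?mem_head ?add0m.
have [GL|GL] := boolP (G \in L).
  suff -> : facet_partial (rcons L G) = facet_partial L by [].
  apply: pred_ext => m; rewrite stepE; split=> [[//|[u uG ->]]|]; last by left.
  by exists G; rewrite ?add0m.
have [a [b [lt_ab EG]]] := edgeP E2 GE; rewrite {}EG in GE ok stepE GL *.
have ab : a != b by rewrite neq_ltn lt_ab.
(* With all flags false the terms coming from x_i disappear. *)
have [|||||s0 [t0 tr]] := @trace_quadrant (covered L a) (covered L b)
  (L != [::]) false false false false false; rewrite //.
- by case: L {LE GL shL stepE ok}.
- by case: L {LE GL shL stepE ok}.
- move: ok; rewrite negbK; case/orP=> [->//|/exists_inP[c]].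
  by rewrite !inE => /orP[]/eqP -> ->; rewrite ?orbT.
apply: (shelled_quadrant (s0 := s0) (t0 := t0) ab GE shL stepE) => [|s t].
  by move=> m m' [G' G'L mG] le_m; exists G' => //; apply: mon_on_le mG le_m.
rewrite -tr add0m /facet_trace !andbF /=.
exact: (bimon_on_seq E2 _ _ LE ab GL).
Qed.

Lemma seq_extend (T : eqType) (Q : seq T -> Prop) (L t : seq T) : Q L ->
  (forall s x, {subset s <= t} -> x \in t ->
     Q (L ++ s) -> Q (rcons (L ++ s) x)) ->
  Q (L ++ t).
Proof.
move=> QL step; elim/last_ind: t step => [|t x IHt] step.
  by rewrite cats0.
rewrite -rcons_cat; apply: (step).
- by move=> y yt; rewrite mem_rcons inE yt orbT.
- by rewrite mem_rcons mem_head.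
apply: IHt => s y st yt; apply: step; last by rewrite mem_rcons inE yt orbT.
by move=> z /st zt; rewrite mem_rcons inE zt orbT.
Qed.

Hypothesis diam2 : forall u v : 'I_n,
  vert u -> vert v -> u != v -> ~~ adj u v ->
  exists w, adj u w && adj w v.

Definition star (v : 'I_n) := [seq G : {set 'I_n} <- enum E | v \in G].
Definition second_star (v : 'I_n) :=
  [seq G : {set 'I_n} <- enum E | [exists a in G, adj v a]].

Lemma covered_cat L L' a : covered (L ++ L') a = covered L a || covered L' a.
Proof. exact: has_cat. Qed.

Lemma star_covers v a : adj v a -> covered (star v) a.
Proof.
move=> /andP[_ vaE]; apply/hasP; exists [set v; a].
  by rewrite mem_filter mem_enum vaE !inE eqxx.
by rewrite !inE eqxx orbT.
Qed.

Lemma star_covers_root v : vert v -> covered (star v) v.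
Proof.
move=> /exists_inP[G GE vG]; apply/hasP; exists G => //.
by rewrite mem_filter vG mem_enum.
Qed.

(** Here diameter two enters: a vertex is [v], a neighbor of [v], or joined to such a neighbor. *)
Lemma second_star_covers v a : vert v -> vert a ->
  covered (star v ++ second_star v) a.
Proof.
move=> vv va; rewrite covered_cat; apply/orP.
have [<-|vNa] := eqVneq v a; first by left; apply: star_covers_root.
have [/star_covers|vaN] := boolP (adj v a); first by left.
have [w /andP[vw /andP[_ waE]]] := diam2 vv va vNa vaN.
right; apply/hasP; exists [set w; a]; last by rewrite !inE eqxx orbT.
rewrite mem_filter mem_enum waE andbT; apply/exists_inP; exists w => //.
by rewrite !inE eqxx.
Qed.

Lemma edge_vert G a : G \in E -> a \in G -> vert a.
Proof. by move=> GE aG; apply/exists_inP; exists G. Qed.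

Lemma edge_neq0 G : G \in E -> exists a, a \in G.
Proof. by move=> /E2 G2; apply/card_gt0P; rewrite G2. Qed.

(** Edges at [v] share [v], the next ones contain a neighbor of [v], already covered, and by then
    every vertex is covered. Repetitions in the list are harmless. *)
Lemma connected_order (Q : seq {set 'I_n} -> Prop) v : vert v -> Q [::] ->
  (forall L G, {subset L <= E} -> G \in E ->
     (L == [::]) || [exists a in G, covered L a] -> Q L -> Q (rcons L G)) ->
  Q (star v ++ second_star v ++ enum E).
Proof.
move=> vv Q0 step.
have starE G : G \in star v -> G \in E.
  by rewrite mem_filter mem_enum => /andP[].
have sstarE G : G \in second_star v -> G \in E.
  by rewrite mem_filter mem_enum => /andP[].
rewrite catA; apply: seq_extend => [|s G sE GE]; last first.
  rewrite mem_enum in GE; apply: step => //.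
    move=> G'; rewrite !mem_cat => /orP[/orP[/starE|/sstarE]|/sE] //.
    by rewrite mem_enum.
  have [a aG] := edge_neq0 GE.
  apply/orP; right; apply/exists_inP; exists a => //.
  by rewrite covered_cat second_star_covers //; apply: edge_vert aG.
apply: seq_extend => [|s G sS GS]; last first.
  apply: step; last apply/orP; [|exact: sstarE|right].
    by move=> G'; rewrite mem_cat => /orP[/starE|/sS/sstarE].
  move: GS; rewrite mem_filter => /andP[/exists_inP[a aG va] _].
  by apply/exists_inP; exists a; rewrite // covered_cat star_covers.
rewrite -[star v]cat0s; apply: seq_extend => // s G sS GS.
apply: step; [by move=> G' /sS/starE|exact: starE|].
case: s sS => [//|G' s] sS; apply/orP; right; apply/exists_inP; exists v.
  by move: GS; rewrite mem_filter => /andP[].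
by have := sS G' (mem_head _ _); rewrite mem_filter /= => /andP[-> _].
Qed.

Lemma star_order_mem v : star v ++ second_star v ++ enum E =i E.
Proof.
move=> G; rewrite !mem_cat mem_enum.
case GE : (G \in E); rewrite ?orbT ?orbF //.
by apply/orP => -[|]; rewrite mem_filter mem_enum GE andbF.
Qed.

Lemma facets_shelled v : vert v -> shelled E (low_upto 0).
Proof.
move=> vv; set L := star v ++ second_star v ++ enum E.
have shL : shelled E (facet_partial L).
  apply: (@connected_order (fun L => shelled E (facet_partial L))) => //.
    by apply: shelled_empty => m [].
  exact: facet_partial_step.
suff <- : facet_partial L = low_upto 0 by [].
apply: pred_ext => m; split=> [[G GL mG]|[[G GE mG]|[j]] //].
  by left; exists G => //; rewrite -(star_order_mem v).
by exists G; rewrite // /L star_order_mem.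
Qed.

Lemma low_upto_shelled v i : vert v -> shelled E (low_upto i) ->
  shelled E (low_upto i.+1).
Proof.
move=> vv shi; have shi0 : shelled E (low_partial i [::]).
  suff -> : low_partial i [::] = low_upto i by [].
  by apply: pred_ext => m; split=> [[|[]]|] //; left.
suff [L [LE EL shL]] : exists L, [/\ {subset L <= E}, {subset E <= L}
    & shelled E (low_partial i L)].
  suff <- : low_partial i L = low_upto i.+1 by [].
  apply: pred_ext => m; split=> [[[|[j ji mj]]|[G GL mG]]|[|[j]]].
  - by left.
  - by right; exists j; rewrite // ltnW.
  - by right; exists i => //; exists G; rewrite ?LE.
  - by left; left.
  rewrite ltnS leq_eqVlt => /orP[/eqP/val_inj->|ji] [G GE mG].
    by right; exists G; rewrite ?EL.
  by left; right; exists j => //; exists G.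
(* If [i] is not a vertex, meeting an earlier edge suffices and the root is [v]. If it is, the root
   is [i], and each remaining edge has both ends covered. *)
have [vi|vNi] := boolP (vert i); last first.
  exists (star v ++ second_star v ++ enum E); split=> [G|G|].
  - by rewrite star_order_mem.
  - by rewrite star_order_mem.
  apply: (@connected_order (fun L => shelled E (low_partial i L))) => //.
  move=> L G LE GE ok; apply: low_partial_step => //.
  by rewrite (negPf vNi).
exists (star i ++ second_star i ++ enum E); split=> [G|G|].
- by rewrite star_order_mem.
- by rewrite star_order_mem.
have extend := seq_extend (Q := fun L => shelled E (low_partial i L)).
rewrite catA; apply: (extend) => [|s G sE GE]; last first.
  apply: low_partial_step.
  - move=> G'; rewrite mem_cat => /orP[|/sE]; last by rewrite mem_enum.
    by move=> G'S; rewrite -(star_order_mem i) catA mem_cat G'S.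
  - by rewrite mem_enum in GE.
  rewrite vi; apply/or3P; apply: Or33; apply/forall_inP => a aG.
  rewrite covered_cat second_star_covers //; apply: edge_vert aG.
  by rewrite mem_enum in GE.
rewrite -[star i ++ _]cat0s.
apply: extend => // s G sS.
rewrite mem_cat => GS; have SE G' : G' \in star i ++ second_star i -> G' \in E.
  by move=> G'S; rewrite -(star_order_mem i) catA mem_cat G'S.
apply: low_partial_step => [G' /sS/SE //||].
  by apply: SE; rewrite mem_cat.
by rewrite vi; case/orP: GS; rewrite mem_filter => /andP[-> _]; rewrite ?orbT.
Qed.

Lemma low_shelled v : vert v -> shelled E (low E).
Proof.
move=> vv; suff <- : low_upto n = low E.
  suff shc c : (c <= n)%N -> shelled E (low_upto c) by apply: shc.
  elim: c => [_|c IHc cn]; first exact: facets_shelled vv.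
  exact: (@low_upto_shelled v (Ordinal cn) vv (IHc (ltnW cn))).
apply: pred_ext => m; split=> [[]|].
- by move=> [G GE /outdeg0P m0]; exists G; rewrite ?m0.
- move=> [j _ [G GE [u /outdeg0P u0 ->]]].
  by exists G; rewrite // outdegD u0 outdegU; case: (_ \notin _).
move=> [G GE m2]; have [m0|m0] := posnP (outdeg G m).
  by left; exists G => //; apply/outdeg0P.
have [j jG jm] := outdeg_divisor m0; right; exists j => //; exists G => //.
exists (m - U_(j))%MM; last by rewrite addmC submK.
apply/outdeg0P; move: m2; rewrite -{1}(submK jm) outdegD outdegU jG addn1 !ltnS.
by rewrite leqn0 => /eqP.
Qed.

End ShellingOrder.

(** * Pure one-dimensional complexes *)

Lemma least_nat (P : nat -> Prop) : (exists d, P d) ->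
  exists2 d, P d & forall e, P e -> (d <= e)%N.
Proof.
case=> d; elim/ltn_ind: d => d IHd Pd.
case: (classic (exists2 e, (e < d)%N & P e)) => [[e ed /IHd]|noe]; first exact.
by exists d => // e Pe; rewrite leqNgt; apply/negP => ed; apply: noe; exists e.
Qed.

Section Diameter.
Variables (n : nat) (Delta : {set {set 'I_n}}).
Hypothesis Delta_complex : simplicial_complex Delta.
Hypothesis Delta_pure : pure Delta.
Hypothesis dim_Delta : complex_dim Delta = 1.
Local Notation E := (facets Delta).

Lemma facets_nonempty : exists G, G \in E.
Proof.
apply/set0Pn/eqP => E0; move: dim_Delta; rewrite /complex_dim E0.
by rewrite big_set0.
Qed.

Lemma facet_card G : G \in E -> #|G| = 2.
Proof.
move=> GE; have := dim_Delta; rewrite /complex_dim => dimD.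
suff maxE : \max_(F in E) #|F| = #|G|.
  by move: dimD; rewrite maxE => /eqP; rewrite subr_eq => /eqP[].
apply/eqP; rewrite eqn_leq.
rewrite (@leq_bigmax_cond _ (mem E) (fun F => #|F|)) // andbT.
by apply/bigmax_leqP => F FE; rewrite (Delta_pure FE GE).
Qed.

Lemma verticesE u : (u \in vertices Delta) = vert E u.
Proof.
rewrite inE; apply/idP/exists_inP => [uD|[G + uG]].
  have [G maxG uG] := maxset_exists uD; exists G; first by rewrite inE.
  by rewrite -sub1set.
rewrite inE => /maxsetP[GD _]; apply: Delta_complex GD _.
by rewrite sub1set.
Qed.

Definition diam_le2 := forall u v, vert E u -> vert E v -> u != v ->
  ~~ adjacent E u v -> exists w, adjacent E u w && adjacent E w v.

Lemma short_path u v : diam_le2 -> vert E u -> vert E v ->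
  exists2 s, is_path Delta u v s & (size s <= 2)%N.
Proof.
move=> diam vu vv; have [<-|uv] := eqVneq u v.
  by exists [::]; rewrite /is_path //= eqxx.
have [uv1|uvN] := boolP (adjacent E u v).
  by exists [:: v]; rewrite // /is_path /= inE uv eqxx !andbT.
have [w /andP[uw wv]] := diam u v vu vv uv uvN; exists [:: w; v] => //.
have [[uw' _] [wv' _]] := (andP uw, andP wv).
by rewrite /is_path /= !inE negb_or uw' uv wv' eqxx !andbT; apply/andP.
Qed.

Lemma is_distance_exists u v s : is_path Delta u v s ->
  exists2 d, is_distance Delta u v (Some d) & (d <= size s)%N.
Proof.
move=> ps.
have [|d [t pt <-] least] := @least_nat (fun d => exists2 s, is_path Delta u v s
  & size s = d); first by exists (size s), s.
exists (size t); last by apply: least; exists s.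
by split=> [|t' pt']; [exists t|apply: least; exists t'].
Qed.

Lemma is_diameter_le2 :
  (exists2 D, is_diameter Delta D & le_onat D (Some 2)) <-> diam_le2.
Proof.
split=> [[[D|] // [_ maxD] D2] u v vu vv uv uvN|diam].
  have bound d : is_distance Delta u v d -> le_onat d (Some D).
    by apply: maxD; rewrite verticesE.
  have [s ps] : exists s, is_path Delta u v s.
    apply: NNPP => nos; suff /bound : is_distance Delta u v None by [].
    by move=> s; apply/negP => ps; apply: nos; exists s.
  have [d dd _] := is_distance_exists ps.
  have {}D2 := leq_trans (bound _ dd) D2; case: dd D2 => [[t pt <-] _].
  move: pt; case: t => [|w [|w' [|//]]] /and3P[].
  - by move=> _ _ /eqP /= E0; rewrite E0 eqxx in uv.
  - by rewrite /= andbT => uw _ /eqP /= E0; rewrite -E0 in uvN; case/negP: uvN.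
  rewrite /= andbT => /andP[uw ww'] _ /eqP /= E0 _.
  by exists w; rewrite -E0; apply/andP.
have le2 u v d : u \in vertices Delta -> v \in vertices Delta ->
    is_distance Delta u v d -> le_onat d (Some 2).
  rewrite !verticesE => vu vv; have [s ps s2] := short_path diam vu vv.
  case: d => [d [_ /(_ s ps) ds]|/(_ s)]; first exact: leq_trans ds s2.
  by rewrite ps.
case: (classic (exists u v, [/\ u \in vertices Delta, v \in vertices Delta
    & is_distance Delta u v (Some 2)])) => [D2|ND2].
  by exists (Some 2) => //; split=> // u v d; apply: le2.
(* With no pair at distance 2 the diameter is 1, attained at the ends of any edge. *)
exists (Some 1%N) => //; split; last first.
  move=> u v d vu vv dd; move: (le2 u v d vu vv dd); case: d dd => //= d dd.
  rewrite leq_eqVlt => /orP[/eqP d2|//].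
  by case: ND2; exists u, v; rewrite -d2.
have [G GE] := facets_nonempty.
have [a [b [lt_ab EG]]] := edgeP facet_card GE.
have ab : a != b by rewrite neq_ltn lt_ab.
exists a, b; rewrite !verticesE; split.
- by apply/exists_inP; exists G; rewrite // EG !inE eqxx.
- by apply/exists_inP; exists G; rewrite // EG !inE eqxx orbT.
split=> [|[|//]]; last by case/and3P => _ _; rewrite /= (negPf ab).
exists [:: b]; rewrite // /is_path /= inE ab eqxx !andbT /edge ab -EG.
exact: GE.
Qed.

Lemma sr_symbolic_power2 (k : fieldType) :
  sr_symbolic_power k Delta 2 = @span_compl k n (low E).
Proof.
apply/same_ideal_eq => f; split=> [If m fm [G GE m2]|If G GE].
  by have /var_ideal_pow := If G GE; apply; first exact: fm.
by apply/var_ideal_pow => m /If mE m2; apply: mE; exists G.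
Qed.

Lemma cohen_macaulay_diam_le2 (k : fieldType) :
  cohen_macaulay (@span_compl k n (low E)) -> diam_le2.
Proof.
move=> CM u v /exists_inP vu /exists_inP vv.
exact: cohen_macaulay_common_neighbor facet_card u v CM vu vv.
Qed.

Lemma diam_le2_clean (k : fieldType) :
  diam_le2 -> clean (@span_compl k n (low E)).
Proof.
move=> diam; have [G GE] := facets_nonempty.
have [a aG] := edge_neq0 facet_card GE.
apply: (shelled_clean k facet_card (low_shelled facet_card diam _)).
exact: edge_vert GE aG.
Qed.

End Diameter.

Local Close Scope ring_scope.

Theorem theorem3p1 (k : fieldType) (n : nat) (Delta : {set {set 'I_n}})
    (Delta_complex : simplicial_complex Delta) (Delta_pure : pure Delta)
    (dim_Delta : complex_dim Delta = 1%R) :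
  (clean (sr_symbolic_power k Delta 2) <->
   cohen_macaulay (sr_symbolic_power k Delta 2)) /\
  (cohen_macaulay (sr_symbolic_power k Delta 2) <->
   exists2 D : option nat, is_diameter Delta D & le_onat D (Some 2)).
Proof.
have cards := facet_card Delta_pure dim_Delta.
have diamE := is_diameter_le2 Delta_complex Delta_pure dim_Delta.
rewrite sr_symbolic_power2.
have ab := clean_cohen_macaulay (k := k) cards.
have bc := cohen_macaulay_diam_le2 Delta_pure dim_Delta (k := k).
have ca := diam_le2_clean Delta_pure dim_Delta k.
by split; split; [exact: ab|move/bc|move/bc/diamE|move/diamE/ca].
Qed.
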